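(* Let $N\ge 2$ be a fixed integer, let $R>0$ be given, and let $$b=\max\left\{\frac{\ln 4}{2\pi},\ \frac{4R\left(\sqrt{\pi}+\sqrt{2\pi}+24\pi^2R\exp(2\pi^{3/2}R)\right)}{\sqrt[N]{8^N+3^{N-1}}-8}\right\}.$$ Then there is a constant $A_R>0$ depending only on $R$ such that, for any two potentials $\mathrm q=[q_j]_{j=1}^N$ and $\tilde{\mathrm q}=[\tilde q_j]_{j=1}^N$ on the star-graph satisfying $$\omega_j=\tilde\omega_j,\quad j=1,\dots,N,\qquad \|\mathrm q\|<R,\qquad \|\tilde{\mathrm q}\|<R,$$ the corresponding Weyl vectors $\mathrm M$, $\tilde{\mathrm M}$ satisfy $$\|\mathrm M-\tilde{\mathrm M}\|_{L_2(\mathbb R+ib)}\le A_R\,\|\mathrm q-\tilde{\mathrm q}\|.$$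
   Context: Star-graph with $N$ edges of length $\pi$ ($N\ge2$ fixed). A potential is a vector function $\mathrm q=[q_j]_{j=1}^N$ with complex-valued $q_j\in L_2(0,\pi)$, with norm $\|\mathrm q\|=\max_{1\le j\le N}\|q_j\|_{L_2(0,\pi)}$. Put $\omega_j=\frac12\int_0^\pi q_j(t)\,dt$. For $\lambda\in\mathbb C$ consider the system $$-y_j''(x)+q_j(x)y_j(x)=\lambda y_j(x),\quad x\in(0,\pi),\ j=1,\dots,N,$$ with matching conditions $y_1(0)=y_j(\pi)$ for $j=2,\dots,N$ and $y_1'(0)=\sum_{j=2}^N y_j'(\pi)$. For $k=2,\dots,N$ the Weyl solution $\Phi_k(x,\lambda)=[\Phi_{jk}(x,\lambda)]_{j=1}^N$ is the solution of this system (including the matching conditions) satisfying $\Phi_{1k}(\pi,\lambda)=0$ and $\Phi_{jk}(0,\lambda)=\delta_{jk}$ for $j=2,\dots,N$ ($\delta_{jk}$ is the Kronecker delta). The Weyl functions are $M_k(\lambda)=\Phi_{kk}'(0,\lambda)$ (derivative in $x$), $k=2,\dots,N$; they are meromorphic in $\lambda$. The Weyl vector is $\mathrm M(\lambda)=[M_k(\lambda)]_{k=2}^N$. Objects with a tilde ($\tilde\omega_j$, $\tilde M_k$, $\tilde{\mathrm M}$) are the same objects constructed from $\tilde{\mathrm q}$. For $\tau>0$, $$\|\mathrm M-\tilde{\mathrm M}\|_{L_2(\mathbb R+i\tau)}:=\max_{2\le k\le N}\left(\int_{\mathbb R+i\tau}|M_k(\rho^2)-\tilde M_k(\rho^2)|^2\,d\rho\right)^{1/2}.$$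 *)

(* Defs.v *)
From HB Require Import structures.
From mathcomp Require Import all_boot all_order all_algebra.
From mathcomp Require Import all_classical all_reals all_analysis.
From mathcomp Require Export complex.

Set Implicit Arguments.
Unset Strict Implicit.
Unset Printing Implicit Defensive.

Import Order.TTheory GRing.Theory Num.Theory.
Import numFieldNormedType.Exports.

Local Open Scope classical_set_scope.
Local Open Scope ring_scope.

(* Edges of the star graph are labelled by 'I_N: edge j = 1, ..., N is
   the ordinal of value j - 1, so edge 1 is the ordinal of value 0 and the range
   j = 2, ..., N is the set of ordinals of nonzero value. *)

Section StarGraph.
Context {R : realType}.
Notation mu := (@lebesgue_measure R).

Definition cintegral (D : set R) (f : R -> R[i]) : R[i] :=
  Complex (Rintegral mu D (fun x => complex.Re (f x)))
          (Rintegral mu D (fun x => complex.Im (f x))).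

Definition cmeasurable_fun (D : set R) (f : R -> R[i]) : Prop :=
  measurable_fun D (fun x => complex.Re (f x)) /\ measurable_fun D (fun x => complex.Im (f x)).

Definition cintegrable (D : set R) (f : R -> R[i]) : Prop :=
  mu.-integrable D (fun x => (complex.Re (f x))%:E) /\
  mu.-integrable D (fun x => (complex.Im (f x))%:E).

Definition L2norm (D : set R) (f : R -> R[i]) : \bar R :=
  ((\int[mu]_(x in D) ((Normc.normc (f x)) ^+ 2)%:E) `^ (2^-1)%R)%E.

Definition inL2 (D : set R) (f : R -> R[i]) : Prop :=
  cmeasurable_fun D f /\ (L2norm D f < +oo)%E.

(* f is differentiable at x relatively to [0, pi] (one-sided at 0 and pi), with
   derivative d. *)
Definition has_derivative (f : R -> R[i]) (x : R) (d : R[i]) : Prop :=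
  ((fun t => (complex.Re (f t) - complex.Re (f x)) / (t - x))
     @ within `[0, pi] x^' --> complex.Re d) /\
  ((fun t => (complex.Im (f t) - complex.Im (f x)) / (t - x))
     @ within `[0, pi] x^' --> complex.Im d).

(* f is absolutely continuous on [0, pi], i.e. an indefinite Lebesgue integral,
   and its almost everywhere defined derivative is g. *)
Definition abs_continuous_with (f g : R -> R[i]) : Prop :=
  cintegrable `[0, pi] g /\
  forall x : R, 0 <= x <= pi -> f x = f 0 + cintegral `[0, x] g.

(* y solves - y'' + q y = lambda y on (0, pi) and dy is its derivative on
   [0, pi]: as q is only square integrable, y' is required to be absolutely
   continuous and the equation to hold almost everywhere. *)
Definition SL_solution (q : R -> R[i]) (lambda : R[i]) (y dy : R -> R[i]) :
    Prop :=
  (forall x : R, 0 <= x <= pi -> has_derivative y x (dy x)) /\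
  exists d2y : R -> R[i], abs_continuous_with dy d2y /\
    {ae mu, forall x : R, 0 < x < pi -> - d2y x + q x * y x = lambda * y x}.

Section Graph.
Context {N : nat}.
Implicit Types q y dy : 'I_N -> R -> R[i].

Definition potential q : Prop := forall j, inL2 `]0, pi[ (q j).

Definition potential_norm q : \bar R :=
  \big[maxe/0%E]_(j < N) L2norm `]0, pi[ (q j).

Definition omega q (j : 'I_N) : R[i] := 2^-1 * cintegral `]0, pi[ (q j).

Definition matching y dy : Prop :=
  forall r : 'I_N, val r = 0%N ->
    (forall j : 'I_N, val j != 0%N -> y r 0 = y j pi) /\
    dy r 0 = \sum_(j < N | val j != 0%N) dy j pi.

Definition graph_solution q (lambda : R[i]) y dy : Prop :=
  (forall j, SL_solution (q j) lambda (y j) (dy j)) /\ matching y dy.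

Definition weyl_solution q (k : 'I_N) (lambda : R[i]) y dy : Prop :=
  [/\ graph_solution q lambda y dy,
      forall r : 'I_N, val r = 0%N -> y r pi = 0 &
      forall j : 'I_N, val j != 0%N -> y j 0 = (j == k)%:R].

(* M_k(lambda) = Phi_kk'(0, lambda). The Weyl solution exists and is unique
   except for lambda in a discrete set, which contains the poles of M_k; there
   the value returned here is irrelevant. *)
Definition weyl_function q (k : 'I_N) (lambda : R[i]) : R[i] :=
  xget 0 [set m | exists y dy, weyl_solution q k lambda y dy /\ m = dy k 0].

(* The line R + i tau is parametrised by rho = x + i tau, so d rho = d x. *)
Definition weyl_dist (tau : R) q (qt : 'I_N -> R -> R[i]) : \bar R :=
  \big[maxe/0%E]_(k < N | val k != 0%N)
     L2norm setT (fun x : R =>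
       weyl_function q k (Complex x tau ^+ 2) -
       weyl_function qt k (Complex x tau ^+ 2)).

End Graph.

Definition line_height (N : nat) (r : R) : R :=
  Num.max (ln 4 / (2 * pi))
    (4 * r * (Num.sqrt pi + Num.sqrt (2 * pi)
              + 24 * pi ^+ 2 * r * expR (2 * pi `^ (3 / 2) * r))
     / ((8 ^+ N + 3 ^+ N.-1) `^ (N%:R^-1) - 8)).

End StarGraph.

(* Main.v *)
Require Import Defs.
From HB Require Import structures.
From mathcomp Require Import all_boot all_order all_algebra.
From mathcomp Require Import all_classical all_reals all_analysis.
From mathcomp Require Import measurable_realfun.
From mathcomp Require Import ring lra.

(* Multiplying the equations of the two problems by each other's Weyl solutions and
   integrating over the graph gives
     M_k - Mt_k = sum_j int_0^pi (qt_j - q_j) Phi_jk Phit_jk dx.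
   On the line Im rho = b the Weyl solutions are bounded and differ by O(1/rho)
   from the Weyl solution of the zero potential: the waves u = y' - i rho y and
   v = y' + i rho y are damped along the edges by e^(-b x), a round trip on an edge
   costs the factor e^(-2 pi b) <= 1/4, and b >= 17 sqrt(pi) R makes the potential a
   contractive perturbation of the resulting scattering problem, which also yields
   existence by Picard iteration. The zero-potential solution is a combination of
   e^(i rho x) and e^(i rho (pi - x)); its square contributes Fourier integrals of
   qt_j - q_j, square integrable in rho by Bessel's inequality, and a constant, which
   the hypothesis omega_j = omegat_j annihilates. The O(1/rho) remainder is square
   integrable on the line. *)

Set Implicit Arguments.
Unset Strict Implicit.
Unset Printing Implicit Defensive.

Import Order.TTheory GRing.Theory Num.Theory.
Import numFieldNormedType.Exports.

Local Open Scope classical_set_scope.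
Local Open Scope ring_scope.

(** Where no Weyl solution exists, [weyl_function] is the default value of [xget], so existence is
    required at every point of the line and not merely almost everywhere. The estimates hold for
    every Weyl solution, hence for the one that [xget] selects. The identity for M_k - Mt_k is
    linear in qt - q. This gives a Lipschitz bound, as the solutions themselves need only bounds
    depending on R and b. The height b enters through two consequences. The term ln 4 / (2 pi) gives
    |e^(i rho pi)| <= 1/2. In the other term 8^N + 3^(N-1) <= (33/4)^N, so the denominator is at
    most 1/4 and the term exceeds 17 sqrt(pi) R. Here sqrt(pi) R bounds the L1 norm of a potential
    on an edge, and 17 makes 17/2 sqrt(pi) R / |rho| <= 1/2, the contraction factor. The bounds on
    the solutions do not depend on N, because the vertex value is an average over the edges. The
    leading term has no pointwise decay in rho that would make it square integrable with a bound by
    the norm of qt - q; only its reading as a Fourier integral does. *)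

Local Notation Re := complex.Re.
Local Notation Im := complex.Im.
Local Notation normc := Normc.normc.

(** * Real and imaginary parts and the modulus of complex numbers *)

Section ComplexModulus.
Context {R : realType}.
Implicit Types (x y z : R[i]) (a : R).

Lemma cReD x y : Re (x + y) = Re x + Re y. Proof. by case: x; case: y. Qed.
Lemma cImD x y : Im (x + y) = Im x + Im y. Proof. by case: x; case: y. Qed.
Lemma cReN x : Re (- x) = - Re x. Proof. by case: x. Qed.
Lemma cImN x : Im (- x) = - Im x. Proof. by case: x. Qed.
Lemma cReM x y : Re (x * y) = Re x * Re y - Im x * Im y.
Proof. by case: x; case: y. Qed.
Lemma cImM x y : Im (x * y) = Re x * Im y + Im x * Re y.
Proof. by case: x; case: y. Qed.

Lemma complex_ext x y : Re x = Re y -> Im x = Im y -> x = y.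
Proof. by case: x => a b; case: y => c d /= -> ->. Qed.

Lemma normc_ge0 x : 0 <= normc x.
Proof. by case: x => a b; exact: sqrtr_ge0. Qed.

Lemma sqr_normc x : normc x ^+ 2 = Re x ^+ 2 + Im x ^+ 2.
Proof. by case: x => a b /=; rewrite sqr_sqrtr// addr_ge0// sqr_ge0. Qed.

Lemma ler_normcD x y : normc (x + y) <= normc x + normc y.
Proof. by have := ler_normD x y; rewrite -lecR rmorphD. Qed.

Lemma normcN x : normc (- x) = normc x.
Proof. by case: x => a b /=; rewrite !sqrrN. Qed.

Lemma ler_normcB x y : normc (x - y) <= normc x + normc y.
Proof. by rewrite -(normcN y) ler_normcD. Qed.

Lemma normc_distC x y : normc (x - y) = normc (y - x).
Proof. by rewrite -normcN opprB. Qed.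

Lemma ler_normc_dist x y : normc x - normc y <= normc (x - y).
Proof. by rewrite lerBlDr -[X in normc X <= _](subrK y) ler_normcD. Qed.

Lemma ler_Re_normc x : `|Re x| <= normc x.
Proof.
rewrite -(ler_pXn2r (n := 2)) ?nnegrE ?normc_ge0//.
by rewrite sqr_normc real_normK ?num_real// lerDl sqr_ge0.
Qed.

Lemma ler_Im_normc x : `|Im x| <= normc x.
Proof.
rewrite -(ler_pXn2r (n := 2)) ?nnegrE ?normc_ge0//.
by rewrite sqr_normc real_normK ?num_real// lerDr sqr_ge0.
Qed.

Lemma normc_le_ReIm x : normc x <= `|Re x| + `|Im x|.
Proof.
rewrite -(ler_pXn2r (n := 2)) ?nnegrE ?normc_ge0 ?addr_ge0//.
rewrite sqr_normc sqrrD !real_normK ?num_real// lerD2r lerDl.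
by rewrite mulrn_wge0// mulr_ge0.
Qed.

Lemma normcX x n : normc (x ^+ n) = normc x ^+ n.
Proof.
by elim: n => [|n ih]; rewrite ?expr0 ?Normc.normc1// !exprS Normc.normcM ih.
Qed.

Lemma normc_real a : normc (Complex a 0) = `|a|.
Proof. by rewrite /= expr0n/= addr0 sqrtr_sqr. Qed.

Lemma normc_nat n : normc (n%:R : R[i]) = n%:R.
Proof.
have -> : (n%:R : R[i]) = Complex n%:R 0 by rewrite -(rmorph_nat (real_complex R)).
by rewrite normc_real ger0_norm.
Qed.

Lemma ler_normc_sum I (s : seq I) (P : pred I) (F : I -> R[i]) :
  normc (\sum_(i <- s | P i) F i) <= \sum_(i <- s | P i) normc (F i).
Proof.
elim/big_ind2 : _ => //; first by rewrite Normc.normc0.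
by move=> x1 x2 y1 y2 h1 h2; rewrite (le_trans (ler_normcD _ _))// lerD.
Qed.

End ComplexModulus.

(** * Lebesgue integration of complex-valued functions *)

Section ComplexIntegral.
Context {R : realType}.
Notation mu := (@lebesgue_measure R).
Implicit Types (D : set (measurableTypeR R)) (f g : R -> R[i]).

Lemma integrable_EFinD D (f g : R -> R) : measurable D ->
  mu.-integrable D (EFin \o f) -> mu.-integrable D (EFin \o g) ->
  mu.-integrable D (EFin \o (fun x => f x + g x)).
Proof. by move=> mD fi gi; have := integrableD mD fi gi. Qed.

Lemma integrable_EFinZ D (c : R) (f : R -> R) : measurable D ->
  mu.-integrable D (EFin \o f) ->
  mu.-integrable D (EFin \o (fun x => c * f x)).
Proof. by move=> mD fi; have := integrableZl mD c fi. Qed.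

Lemma eq_cintegral D f g : {in D, f =1 g} -> cintegral D f = cintegral D g.
Proof.
by move=> fg; congr Complex; apply: eq_Rintegral => x /fg ->.
Qed.

Lemma eq_cintegrable D f g : measurable D -> {in D, f =1 g} -> cintegrable D f -> cintegrable D g.
Proof.
move=> mD fg [f1 f2]; split.
- by apply: eq_integrable f1 => // x /fg /= ->.
- by apply: eq_integrable f2 => // x /fg /= ->.
Qed.

Lemma cintegrableS D (E : set (measurableTypeR R)) f : measurable E -> measurable D -> D `<=` E ->
  cintegrable E f -> cintegrable D f.
Proof. by move=> mE mD DE [? ?]; split; apply: (integrableS mE). Qed.

Lemma cintegrableD D f g : measurable D -> cintegrable D f -> cintegrable D g ->
  cintegrable D (fun x => f x + g x).
Proof.
move=> mD [f1 f2] [g1 g2]; split.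
- by under eq_fun do rewrite cReD EFinD; exact: integrableD.
- by under eq_fun do rewrite cImD EFinD; exact: integrableD.
Qed.

Lemma cintegralD D f g : measurable D -> cintegrable D f -> cintegrable D g ->
  cintegral D (fun x => f x + g x) = cintegral D f + cintegral D g.
Proof.
move=> mD [f1 f2] [g1 g2]; apply: complex_ext; rewrite ?(cReD, cImD)/=.
- by under eq_Rintegral do rewrite cReD; rewrite RintegralD.
- by under eq_Rintegral do rewrite cImD; rewrite RintegralD.
Qed.

Lemma cmeasurableM D f g : cmeasurable_fun D f -> cmeasurable_fun D g ->
  cmeasurable_fun D (fun x => f x * g x).
Proof.
move=> [f1 f2] [g1 g2]; split.
- under eq_fun do rewrite cReM.
  by apply: measurable_funB; exact: measurable_funM.
- under eq_fun do rewrite cImM.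
  by apply: measurable_funD; exact: measurable_funM.
Qed.

Lemma cmeasurableD D f g : cmeasurable_fun D f -> cmeasurable_fun D g ->
  cmeasurable_fun D (fun x => f x + g x).
Proof.
by move=> [f1 f2] [g1 g2]; split;
  [under eq_fun do rewrite cReD|under eq_fun do rewrite cImD];
  exact: measurable_funD.
Qed.

Lemma cmeasurable_cst D (c : R[i]) : cmeasurable_fun D (fun=> c).
Proof. by split; exact: measurable_cst. Qed.

Lemma cmeasurableN D f : cmeasurable_fun D f ->
  cmeasurable_fun D (fun x => - f x).
Proof.
move=> /(cmeasurableM (cmeasurable_cst D (-1))).
by under eq_fun do rewrite mulN1r.
Qed.

Lemma cmeasurable_normc D f : cmeasurable_fun D f ->
  measurable_fun D (fun x => normc (f x)).
Proof.
move=> [f1 f2].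
have -> : (fun x => normc (f x)) =
    Num.sqrt \o (fun x => Re (f x) ^+ 2 + Im (f x) ^+ 2).
  by apply/funext => x /=; case: (f x).
apply: (measurableT_comp (continuous_measurable_fun (@sqrt_continuous R))).
by apply: measurable_funD; exact: measurable_funX.
Qed.

Lemma cintegrable_measurable D f : cintegrable D f -> cmeasurable_fun D f.
Proof.
move=> [f1 f2]; split.
- by have /measurable_EFinP := measurable_int _ f1.
- by have /measurable_EFinP := measurable_int _ f2.
Qed.

Lemma cintegrable_normc D f : measurable D -> cintegrable D f ->
  mu.-integrable D (EFin \o (fun x => normc (f x))).
Proof.
move=> mD fi; have [f1 f2] := fi.
apply: (@le_integrable _ _ _ _ _ mD _
  (fun x => `|(Re (f x))%:E| + `|(Im (f x))%:E|)%E).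
- apply/measurable_EFinP.
  exact: (cmeasurable_normc (cintegrable_measurable fi)).
- move=> x Dx /=; rewrite lee_fin ger0_norm ?normc_ge0//.
  by rewrite ger0_norm ?addr_ge0// normc_le_ReIm.
- by apply: integrableD => //; exact: integrable_abse.
Qed.

Lemma cintegrable_le D f (g : R -> R) : measurable D -> cmeasurable_fun D f ->
  mu.-integrable D (EFin \o g) -> (forall x, D x -> normc (f x) <= g x) ->
  cintegrable D f.
Proof.
move=> mD [f1 f2] gi fg; split; apply: le_integrable gi => //;
  try exact/measurable_EFinP.
- move=> x Dx; rewrite /= lee_fin (le_trans (ler_Re_normc _))//.
  by rewrite (le_trans (fg _ Dx))// ler_norm.
- move=> x Dx; rewrite /= lee_fin (le_trans (ler_Im_normc _))//.
  by rewrite (le_trans (fg _ Dx))// ler_norm.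
Qed.

Lemma cintegrableMl D f g (M : R) : measurable D -> cmeasurable_fun D f ->
  (forall x, D x -> normc (f x) <= M) -> cintegrable D g ->
  cintegrable D (fun x => f x * g x).
Proof.
move=> mD mf fM gi.
apply: (@cintegrable_le _ _ (fun x => M * normc (g x))) => //.
- by apply: cmeasurableM => //; exact: cintegrable_measurable.
- exact: integrable_EFinZ (cintegrable_normc mD gi).
- by move=> x Dx; rewrite Normc.normcM ler_wpM2r ?normc_ge0 ?fM.
Qed.

Lemma cintegrableZ D (c : R[i]) g : measurable D -> cintegrable D g ->
  cintegrable D (fun x => c * g x).
Proof.
by move=> mD; apply: (cintegrableMl mD (cmeasurable_cst D c)).
Qed.

Lemma cintegralZ D (c : R[i]) f : measurable D -> cintegrable D f ->
  cintegral D (fun x => c * f x) = c * cintegral D f.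
Proof.
move=> mD [f1 f2].
have i1 (r : R) : mu.-integrable D (EFin \o (fun x => r * Re (f x))).
  exact: integrable_EFinZ f1.
have i2 (r : R) : mu.-integrable D (EFin \o (fun x => r * Im (f x))).
  exact: integrable_EFinZ f2.
apply: complex_ext; rewrite ?(cReM, cImM)/=.
- by under eq_Rintegral do rewrite cReM; rewrite RintegralB// !RintegralZl.
- by under eq_Rintegral do rewrite cImM; rewrite RintegralD// !RintegralZl.
Qed.

Lemma cintegrableN D f : measurable D -> cintegrable D f ->
  cintegrable D (fun x => - f x).
Proof.
by move=> mD /(cintegrableZ (-1) mD); under eq_fun do rewrite mulN1r.
Qed.

Lemma cintegralN D f : measurable D -> cintegrable D f ->
  cintegral D (fun x => - f x) = - cintegral D f.
Proof.
move=> mD fi; rewrite -mulN1r -cintegralZ//.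
by under eq_fun do rewrite -mulN1r.
Qed.

Lemma cintegrableB D f g : measurable D -> cintegrable D f -> cintegrable D g ->
  cintegrable D (fun x => f x - g x).
Proof. by move=> mD fi gi; apply: cintegrableD => //; exact: cintegrableN. Qed.

Lemma cintegralB D f g : measurable D -> cintegrable D f -> cintegrable D g ->
  cintegral D (fun x => f x - g x) = cintegral D f - cintegral D g.
Proof.
move=> mD fi gi; rewrite cintegralD ?cintegralN//; exact: cintegrableN.
Qed.

(* Rotate the integral onto the positive half-line: |w|^2 = Re (conj w * w). *)
Lemma le_normc_cintegral D f : measurable D -> cintegrable D f ->
  normc (cintegral D f) <= Rintegral mu D (fun x => normc (f x)).
Proof.
move=> mD fi; set w := cintegral D f.
have [w0|w0] := eqVneq (normc w) 0.
  by rewrite w0; apply: Rintegral_ge0 => x _; exact: normc_ge0.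
have wgt : 0 < normc w by rewrite lt_neqAle eq_sym w0 normc_ge0.
rewrite -(ler_pM2l wgt) -expr2 sqr_normc.
have ni := cintegrable_normc mD fi.
rewrite -RintegralZl//.
have cE : Re w ^+ 2 + Im w ^+ 2 = Re (Complex (Re w) (- Im w) * w).
  by rewrite cReM/= mulNr opprK !expr2.
rewrite cE -(cintegralZ _ mD fi) /=.
apply: le_Rintegral => //.
- by have [] := cintegrableZ (Complex (Re w) (- Im w)) mD fi.
- exact: integrable_EFinZ.
- move=> x _; rewrite (le_trans (ler_norm _))// (le_trans (ler_Re_normc _))//.
  by rewrite Normc.normcM/= sqrrN; case: (w).
Qed.

Lemma le_normc_cintegral_bound D f (g : R -> R) : measurable D ->
  cmeasurable_fun D f ->
  mu.-integrable D (EFin \o g) -> (forall x, D x -> normc (f x) <= g x) ->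
  normc (cintegral D f) <= Rintegral mu D g.
Proof.
move=> mD mf gi fg; have fi := cintegrable_le mD mf gi fg.
apply: (le_trans (le_normc_cintegral mD fi)); apply: le_Rintegral => //.
exact: cintegrable_normc.
Qed.

Lemma integrable_cst_itv (a b k : R) : mu.-integrable `[a, b] (EFin \o (fun=> k)).
Proof.
apply: measurable_bounded_integrable => //.
- rewrite /= lebesgue_measure_itv/=; case: ifP => // _.
  by rewrite -EFinD ltry.
- by exists `|k|; split; [exact: num_real|move=> x Mx y _ /=; exact: ltW].
Qed.

Lemma cintegrable_bounded (a b : R) f (M : R) :
  cmeasurable_fun `[a, b] f -> (forall x, a <= x <= b -> normc (f x) <= M) ->
  cintegrable `[a, b] f.
Proof.
move=> mf fM; apply: (@cintegrable_le _ _ (fun=> M)) => //.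
exact: integrable_cst_itv.
Qed.

Lemma Rintegral_itv_split (a b c : R) (f : R -> R) : a <= b -> b <= c ->
  mu.-integrable `[a, c] (EFin \o f) ->
  Rintegral mu `[a, c] f = Rintegral mu `[a, b] f + Rintegral mu `[b, c] f.
Proof.
move=> ab bc fi.
have /= := @Rintegral_itvB R f (BLeft a) (BRight c) b fi.
rewrite !bnd_simp => /(_ ab bc).
rewrite Rintegral_itv_obnd_cbnd; first by move=> <-; rewrite addrC subrK.
by apply: integrableS fi => //; apply: subset_itv; rewrite bnd_simp.
Qed.

Lemma cintegral_itv_split (a b c : R) f : a <= b -> b <= c ->
  cintegrable `[a, c] f ->
  cintegral `[a, c] f = cintegral `[a, b] f + cintegral `[b, c] f.
Proof.
move=> ab bc [f1 f2].
by apply: complex_ext; rewrite ?cReD ?cImD/= (Rintegral_itv_split ab bc).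
Qed.

Lemma cintegral_itv1 (a : R) f : cintegral `[a, a] f = 0.
Proof. by rewrite /cintegral set_itv1 !Rintegral_set1. Qed.

End ComplexIntegral.

(** * Functions with quadratically small increments are constant *)

Section SquareIncrement.
Context {R : realType}.

Lemma le0_geometric (D C : R) : (forall n, D <= C / 2 ^+ n) -> D <= 0.
Proof.
move=> DC; rewrite leNgt; apply/negP => D0.
have C0 : 0 <= C by have := DC 0%N; rewrite expr0 divr1; lra.
pose n := Num.bound (C / D).
have Cn : C / D < n%:R by apply: le_lt_trans (archi_boundP _) => //; exact: divr_ge0 C0 (ltW D0).
have := DC n; rewrite ler_pdivlMr ?exprn_gt0// => h.
have : C < n%:R * D by rewrite -ltr_pdivrMr.
have : n%:R <= 2 ^+ n :> R by rewrite -natrX ler_nat ltnW// ltn_expl.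
move=> h1 h2; have : n%:R * D <= 2 ^+ n * D by rewrite ler_wpM2r// ltW.
lra.
Qed.

(* Cutting [x, y] at the point where L takes its mean value halves the bound. *)
Lemma eq_of_sqr_increment (a b : R) (L : R -> R) (h : R -> R[i]) :
  {within `[a, b], continuous L} ->
  (forall x y, a <= x -> x <= y -> y <= b -> normc (h y - h x) <= (L y - L x) ^+ 2) ->
  (forall x y, a <= x -> x <= y -> y <= b -> L x <= L y) ->
  a <= b -> h b = h a.
Proof.
move=> cL hL Lnd ab.
have main n : forall x y, a <= x -> x <= y -> y <= b ->
    normc (h y - h x) <= (L y - L x) ^+ 2 / 2 ^+ n.
  elim: n => [|n ih] x y ax xy yb; first by rewrite expr0 divr1 hL.
  have cLxy : {within `[x, y], continuous L}.
    apply: continuous_subspaceW cL => z /=; rewrite !in_itv/=; lra.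
  have Lxy : L x <= L y by exact: Lnd.
  have [|m] := @IVT R L x y ((L x + L y) / 2) xy cLxy.
    rewrite min_l// max_r//; lra.
  rewrite in_itv/= => /andP[xm my] Lm.
  have h1 := ih x m ax xm (le_trans my yb).
  have h2 := ih m y (le_trans ax xm) my yb.
  have -> : h y - h x = (h m - h x) + (h y - h m) by ring.
  apply: (le_trans (ler_normcD _ _)).
  apply: (le_trans (lerD h1 h2)).
  rewrite Lm -mulrDl [2 ^+ n.+1]exprS invfM mulrA ler_wpM2r ?invr_ge0 ?exprn_ge0//.
  rewrite le_eqVlt; apply/orP; left.
  by apply/eqP; field.
apply/eqP; rewrite -subr_eq0; apply/eqP/Normc.eq0_normc/eqP.
rewrite eq_le normc_ge0 andbT; apply: (@le0_geometric _ ((L b - L a) ^+ 2)) => n.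
exact: main.
Qed.

End SquareIncrement.

(** * Calculus of absolutely continuous functions on [0, pi] *)

Section AbsolutelyContinuous.
Context {R : realType}.
Notation mu := (@lebesgue_measure R).
Notation AC := abs_continuous_with.
Implicit Types (f g : R -> R[i]) (x y : R).

Let pi0 : 0 <= pi :> R. Proof. exact: pi_ge0. Qed.

Lemma sub_itv_pi x y : 0 <= x -> y <= pi -> `[x, y] `<=` `[(0:R), pi].
Proof. by move=> x0 ypi z /=; rewrite !in_itv/= => /andP[? ?]; lra. Qed.

Lemma cintegrable_sub_pi g x y : 0 <= x -> y <= pi ->
  cintegrable `[0, pi] g -> cintegrable `[x, y] g.
Proof. by move=> x0 ypi; apply: cintegrableS => //; exact: sub_itv_pi. Qed.

Lemma integrable_sub_pi (g : R -> R) x y : 0 <= x -> y <= pi ->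
  mu.-integrable `[0, pi] (EFin \o g) -> mu.-integrable `[x, y] (EFin \o g).
Proof. by move=> x0 ypi; apply: integrableS => //; exact: sub_itv_pi. Qed.

Lemma Rintegral_sub_le (g : R -> R) a b x y : a <= x -> x <= y -> y <= b ->
  mu.-integrable `[a, b] (EFin \o g) -> (forall t, a <= t <= b -> 0 <= g t) ->
  Rintegral mu `[x, y] g <= Rintegral mu `[a, b] g.
Proof.
move=> ax xy yb gi g0.
have ge u v : a <= u -> v <= b -> 0 <= Rintegral mu `[u, v] g.
  move=> au vb; apply: Rintegral_ge0 => t /=; rewrite in_itv/= => /andP[? ?].
  by apply: g0; lra.
rewrite (@Rintegral_itv_split _ a x b)//; last lra.
rewrite (@Rintegral_itv_split _ x y b)//; last first.
  by apply: integrableS gi => // t /=; rewrite !in_itv/= => /andP[? ?]; lra.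
have h1 : 0 <= Rintegral mu `[a, x] g by apply: ge; lra.
have h2 : 0 <= Rintegral mu `[y, b] g by apply: ge; lra.
by rewrite addrCA lerDl addr_ge0.
Qed.

Lemma AC_increment f g x y : AC f g -> 0 <= x -> x <= y -> y <= pi ->
  f y - f x = cintegral `[x, y] g.
Proof.
move=> [gi fE] x0 xy ypi.
rewrite fE; last lra. rewrite [in X in _ - X]fE; last lra.
rewrite (@cintegral_itv_split _ 0 x y)//; first ring.
exact: cintegrable_sub_pi gi.
Qed.

Lemma AC_increment_le f g x y : AC f g -> 0 <= x -> x <= y -> y <= pi ->
  normc (f y - f x) <= Rintegral mu `[x, y] (fun t => normc (g t)).
Proof.
move=> fg x0 xy ypi; rewrite (AC_increment fg)//.
by apply: le_normc_cintegral => //; apply: cintegrable_sub_pi fg.1.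
Qed.

Lemma AC_bounded f g x : AC f g -> 0 <= x <= pi ->
  normc (f x) <= normc (f 0) + Rintegral mu `[0, pi] (fun t => normc (g t)).
Proof.
move=> fg /andP[x0 xpi].
have -> : f x = f 0 + (f x - f 0) by ring.
rewrite (le_trans (ler_normcD _ _))// lerD2l.
rewrite (le_trans (AC_increment_le fg _ _ _))//.
apply: Rintegral_sub_le => //; last by move=> t _; exact: normc_ge0.
by apply: cintegrable_normc => //; exact: fg.1.
Qed.

Definition ccontinuous f :=
  {within `[0, pi], continuous (fun x => Re (f x))} /\
  {within `[0, pi], continuous (fun x => Im (f x))}.

Lemma AC_continuous f g : AC f g -> ccontinuous f.
Proof.
move=> [[g1 g2] fE]; split.
- apply: (@subspace_eq_continuous _ _ _
      (fun x => Re (f 0) + Rintegral mu `[0, x] (fun t => Re (g t)))).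
    move=> x; rewrite inE/= in_itv/= => xpi.
    by rewrite /from_subspace/= (fE _ xpi) cReD.
  move=> x; apply: cvgD; first exact: cvg_cst.
  exact: (@parameterized_integral_continuous R 0 pi (fun t => Re (g t))).
- apply: (@subspace_eq_continuous _ _ _
      (fun x => Im (f 0) + Rintegral mu `[0, x] (fun t => Im (g t)))).
    move=> x; rewrite inE/= in_itv/= => xpi.
    by rewrite /from_subspace/= (fE _ xpi) cImD.
  move=> x; apply: cvgD; first exact: cvg_cst.
  exact: (@parameterized_integral_continuous R 0 pi (fun t => Im (g t))).
Qed.

Lemma ccontinuous_measurable f : ccontinuous f -> cmeasurable_fun `[0, pi] f.
Proof. by move=> [? ?]; split; apply: subspace_continuous_measurable_fun. Qed.

Lemma AC_measurable f g : AC f g -> cmeasurable_fun `[0, pi] f.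
Proof. by move=> /AC_continuous/ccontinuous_measurable. Qed.

Lemma AC_cintegrable f g : AC f g -> cintegrable `[0, pi] f.
Proof.
move=> fg; apply: (cintegrable_bounded (AC_measurable fg)) => x xpi.
exact: (AC_bounded fg).
Qed.

Lemma AC_cintegrableM f g h : AC f g -> cintegrable `[0, pi] h ->
  cintegrable `[0, pi] (fun x => f x * h x).
Proof.
move=> fg; apply: (cintegrableMl _ (AC_measurable fg)) => // x /=.
by rewrite in_itv/=; exact: (AC_bounded fg).
Qed.

Lemma AC_eq f g f1 g1 : AC f g -> (forall x, 0 <= x <= pi -> f1 x = f x) ->
  (forall x, 0 <= x <= pi -> g1 x = g x) -> AC f1 g1.
Proof.
move=> [gi fE] ff gg; split.
  by apply: eq_cintegrable gi => // x; rewrite inE/= in_itv/= => /gg ->.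
move=> x xpi; rewrite !ff//; last by rewrite lexx pi0.
rewrite fE//; congr (_ + _); apply: eq_cintegral => t.
by rewrite inE/= in_itv/= => tx; rewrite gg//; lra.
Qed.

Lemma AC_cst (c : R[i]) : AC (fun=> c) (fun=> 0).
Proof.
split; first by split; exact: integrable0.
by move=> x _; rewrite /cintegral/= !Rintegral_cst//= !mul0r addr0.
Qed.

Lemma AC_D f g f' g' : AC f f' -> AC g g' ->
  AC (fun x => f x + g x) (fun x => f' x + g' x).
Proof.
move=> [fi fE] [gi gE]; split; first exact: cintegrableD.
move=> x xpi; rewrite fE// gE// cintegralD//; first ring.
- by apply: cintegrable_sub_pi fi => //; lra.
- by apply: cintegrable_sub_pi gi => //; lra.
Qed.

Lemma AC_Z (c : R[i]) f f' : AC f f' ->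
  AC (fun x => c * f x) (fun x => c * f' x).
Proof.
move=> [fi fE]; split; first exact: cintegrableZ.
move=> x xpi; rewrite fE// cintegralZ//; first ring.
by apply: cintegrable_sub_pi fi => //; lra.
Qed.

Lemma AC_B f g f' g' : AC f f' -> AC g g' ->
  AC (fun x => f x - g x) (fun x => f' x - g' x).
Proof.
move=> ff /(AC_Z (-1)) gg; apply: AC_eq (AC_D ff gg) _ _ => x _; ring.
Qed.

(** The difference [h] between f g and the integral of the expected derivative is constant: over
    [a, b] its increment is at most the square of the integral of |f'| + |g'|, and
    [eq_of_sqr_increment] applies with [L] the primitive of that sum. *)
Lemma AC_M f g f' g' : AC f f' -> AC g g' ->
  AC (fun x => f x * g x) (fun x => f' x * g x + f x * g' x).
Proof.
move=> ff gg; have [fi fE] := ff; have [gi gE] := gg.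
pose k x := f' x * g x + f x * g' x.
have ki : cintegrable `[0, pi] k.
  apply: cintegrableD => //; last exact: AC_cintegrableM ff gi.
  by apply: eq_cintegrable (AC_cintegrableM gg fi) => // t _; exact: mulrC.
split => // x /andP[x0 xpi].
pose l t := normc (f' t) + normc (g' t).
have nfi := cintegrable_normc (measurable_itv `[0, pi]) fi.
have ngi := cintegrable_normc (measurable_itv `[0, pi]) gi.
have li : mu.-integrable `[0, pi] (EFin \o l) by exact: integrable_EFinD.
have l0 t : 0 <= l t by rewrite addr_ge0 ?normc_ge0.
pose L y := Rintegral mu `[0, y] l.
pose h y := f y * g y - cintegral `[0, y] k.
suff : h x = h 0 by rewrite /h cintegral_itv1 subr0 => /eqP; rewrite subr_eq => /eqP.
have LB a b : 0 <= a -> a <= b -> b <= pi -> L b - L a = Rintegral mu `[a, b] l.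
  move=> a0 ab bpi; rewrite /L (@Rintegral_itv_split _ 0 a b)//; first by ring.
  exact: integrable_sub_pi li.
apply: (@eq_of_sqr_increment _ 0 x L) => //.
- apply: parameterized_integral_continuous => //.
  exact: integrable_sub_pi li.
- move=> a b a0 ab bx; have bpi : b <= pi by lra.
  have fia := cintegrable_sub_pi a0 bpi fi.
  have gia := cintegrable_sub_pi a0 bpi gi.
  have ki' := cintegrable_sub_pi a0 bpi ki.
  have fgi : cintegrable `[a, b] (fun t => g t * f' t).
    by apply: (cintegrable_sub_pi a0 bpi); exact: AC_cintegrableM gg fi.
  have gfi : cintegrable `[a, b] (fun t => f t * g' t).
    by apply: (cintegrable_sub_pi a0 bpi); exact: AC_cintegrableM ff gi.
  have i1 : cintegrable `[a, b] (fun t => g b * f' t - g t * f' t).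
    by apply: cintegrableB => //; exact: cintegrableZ.
  have i2 : cintegrable `[a, b] (fun t => f a * g' t - f t * g' t).
    by apply: cintegrableB => //; exact: cintegrableZ.
  (* This is f b g b - f a g a = g b (f b - f a) + f a (g b - g a), with both increments written as
     integrals. *)
  have -> : h b - h a = cintegral `[a, b] (fun t => (g b * f' t - g t * f' t) +
                                             (f a * g' t - f t * g' t)).
    rewrite cintegralD// !cintegralB//; try exact: cintegrableZ.
    rewrite !cintegralZ//.
    rewrite -(AC_increment ff)// -(AC_increment gg)//.
    rewrite /h (@cintegral_itv_split _ 0 a b)//; last first.
      exact: cintegrable_sub_pi ki.
    have -> : cintegral `[a, b] k = cintegral `[a, b] (fun t => g t * f' t) +
                            cintegral `[a, b] (fun t => f t * g' t).
      by rewrite -cintegralD//; apply: eq_cintegral => t _; rewrite /k; ring.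
    ring.
  have La : 0 <= L b - L a.
    by rewrite LB//; apply: Rintegral_ge0 => t _; exact: l0.
  have lab : mu.-integrable `[a, b] (EFin \o l) by exact: integrable_sub_pi li.
  have bnd f1 f1' u v : AC f1 f1' -> (forall t, normc (f1' t) <= l t) ->
      a <= u -> u <= v -> v <= b -> normc (f1 v - f1 u) <= L b - L a.
    move=> ac1 f1l au uv vb.
    apply: (le_trans (AC_increment_le ac1 _ _ _)); try lra.
    rewrite LB//; apply: (@le_trans _ _ (Rintegral mu `[u, v] l)).
      have iuv : mu.-integrable `[u, v] (EFin \o l).
        by apply: integrable_sub_pi li; lra.
      apply: le_Rintegral => //.
      apply: cintegrable_normc => //; apply: cintegrable_sub_pi ac1.1; lra.
    exact: Rintegral_sub_le.
  (* One factor of the square bounds |g b - g t| and |f a - f t| uniformly in t; the other is kept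
     as the integral of [l]. *)
  rewrite expr2 {2}LB// -RintegralZl//.
  apply: le_normc_cintegral_bound => //.
  + by apply: cintegrable_measurable; exact: cintegrableD.
  + exact: integrable_EFinZ lab.
  + move=> t /=; rewrite in_itv/= => /andP[at_ tb].
    rewrite -!mulrBl (le_trans (ler_normcD _ _))// !Normc.normcM.
    rewrite mulrDr lerD// ler_wpM2r ?normc_ge0//.
    * by apply: (bnd _ _ _ _ gg) => // z; rewrite /l lerDr normc_ge0.
    * rewrite normc_distC.
      by apply: (bnd _ _ _ _ ff) => // z; rewrite /l lerDl normc_ge0.
- move=> a b a0 ab bx; rewrite -subr_ge0 LB//; last lra.
  by apply: Rintegral_ge0 => t _; exact: l0.
Qed.

End AbsolutelyContinuous.

(** * Derivatives relative to [0, pi] and the fundamental theorem of calculus *)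

Section OneSidedDerivatives.
Context {R : realType}.
Notation mu := (@lebesgue_measure R).
Notation AC := abs_continuous_with.
Implicit Types (F G : R -> R) (x t : R).

Let pi0 : 0 < pi :> R. Proof. exact: pi_gt0. Qed.

(** Multiplying out the quotient removes the exception t = x, so the estimate can be used at
    interior points and at both ends alike. *)
Lemma difference_quotientP F x (d : R) :
  ((fun t => (F t - F x) / (t - x)) @ within `[0, pi] x^' --> d) <->
  (forall e : R, 0 < e -> exists2 r : R, 0 < r & forall t, 0 <= t <= pi ->
     `|t - x| < r -> `|F t - F x - d * (t - x)| <= e * `|t - x|).
Proof.
have quot t : t != x -> d - (F t - F x) / (t - x) =
    - ((F t - F x - d * (t - x)) / (t - x)).
  by move=> tx; field; rewrite subr_eq0.
split=> [/cvgrPdist_le h e e0|h].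
- have := h e e0; rewrite !near_withinE => /nbhs_ballP[r /= r0 hr].
  exists r => // t tpi txr; have [->|tx] := eqVneq t x.
    by rewrite !subrr mulr0 subr0 normr0 mulr0.
  have := hr t; rewrite /ball/= distrC => /(_ txr) /(_ _) /(_ _).
  rewrite in_itv/= => /(_ tx tpi).
  rewrite quot// normrN normrM normfV ler_pdivrMr//.
  by rewrite normr_gt0 subr_eq0.
- apply/cvgrPdist_le => e e0; rewrite !near_withinE.
  have [r r0 hr] := h e e0; apply/nbhs_ballP; exists r => //= t.
  rewrite /ball/= distrC => txr tx; rewrite in_itv/= => tpi.
  rewrite quot// normrN normrM normfV ler_pdivrMr; first exact: hr.
  by rewrite normr_gt0 subr_eq0.
Qed.

Lemma continuous_withinP F x : {within `[0, pi], continuous F} -> 0 <= x <= pi ->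
  forall e : R, 0 < e -> exists2 r : R, 0 < r & forall t, 0 <= t <= pi ->
     `|t - x| < r -> `|F t - F x| <= e.
Proof.
move=> cF xpi e e0; have := cF x.
have xin : x \in `[0, pi]%classic by rewrite inE/= in_itv.
rewrite /continuous_at /nbhs/= -nbhs_subspace_in; last by rewrite inE in xin.
move=> /cvgrPdist_le /(_ e e0); rewrite near_withinE => /nbhs_ballP[r /= r0 hr].
exists r => // t tpi txr; rewrite distrC; apply: hr => //=.
by rewrite /ball/= distrC.
Qed.

Lemma Rintegral_near_cst G (a b c e : R) : a <= b ->
  mu.-integrable `[a, b] (EFin \o G) ->
  (forall t, a <= t <= b -> `|G t - c| <= e) ->
  `|Rintegral mu `[a, b] G - c * (b - a)| <= e * (b - a).
Proof.
move=> ab Gi Gc.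
have cint k : Rintegral mu `[a, b] (fun=> k) = k * (b - a).
  rewrite Rintegral_cst//= lebesgue_measure_itv/= lte_fin.
  case: ltP => //= ba.
  by have -> : a = b; [lra|rewrite subrr].
have ci k : mu.-integrable `[a, b] (EFin \o (fun=> k)).
  exact: integrable_cst_itv.
have Gci : mu.-integrable `[a, b] (EFin \o (fun t => G t - c)).
  exact: integrable_EFinD.
rewrite -cint -RintegralB// -cint.
apply: (le_trans (le_normr_Rintegral _ Gci)) => //.
by apply: le_Rintegral => //; exact: integrable_norm Gci.
Qed.

Lemma difference_quotient_integral F G x :
  mu.-integrable `[0, pi] (EFin \o G) ->
  (forall t, 0 <= t <= pi -> F t = F 0 + Rintegral mu `[0, t] G) ->
  {within `[0, pi], continuous G} -> 0 <= x <= pi ->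
  (fun t => (F t - F x) / (t - x)) @ within `[0, pi] x^' --> G x.
Proof.
move=> Gi FE cG xpi; apply/difference_quotientP => e e0.
have [r r0 hr] := continuous_withinP cG xpi e0.
exists r => // t tpi txr.
have incr (a b : R) : 0 <= a -> a <= b -> b <= pi -> F b - F a = Rintegral mu `[a, b] G.
  move=> a0 ab bpi; rewrite FE; last lra.
  rewrite [in X in _ - X]FE; last lra.
  rewrite (@Rintegral_itv_split _ 0 a b)//; first by ring.
  exact: integrable_sub_pi Gi.
have [xt|tx] := leP x t.
- rewrite incr// ?[`|t - x|]ger0_norm ?subr_ge0//; try lra.
  apply: Rintegral_near_cst => //; first by apply: integrable_sub_pi Gi; lra.
  move=> s sxt; apply: hr; first lra.
  by move: txr; rewrite !ger0_norm ?subr_ge0//; lra.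
- have -> : F t - F x - G x * (t - x) = - (F x - F t - G x * (x - t)) by ring.
  rewrite normrN [`|t - x|]distrC incr ?[`|x - t|]ger0_norm ?subr_ge0//; try lra.
  apply: Rintegral_near_cst => //; [lra|by apply: integrable_sub_pi Gi; lra|].
  move=> s sxt; apply: hr; first lra.
  by move: txr; rewrite !ler0_norm ?subr_le0//; lra.
Qed.

Lemma within_FTC2 F G x :
  (forall x, 0 <= x <= pi ->
     (fun t => (F t - F x) / (t - x)) @ within `[0, pi] x^' --> G x) ->
  {within `[0, pi], continuous G} -> 0 <= x <= pi ->
  F x = F 0 + Rintegral mu `[0, x] G.
Proof.
move=> dF cG /andP[x0 xpi].
have [->|xneq0] := eqVneq x 0; first by rewrite set_itv1 Rintegral_set1 addr0.
have xgt0 : 0 < x by rewrite lt_neqAle eq_sym xneq0.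
(* [continuous_FTC2] asks for one-sided continuity at 0 and x. It follows from |F s - F t| <= (|G t|
   + 1) |s - t| near t. *)
have lip t : 0 <= t <= pi -> forall e : R, 0 < e -> exists2 r : R, 0 < r &
    forall s, 0 <= s <= pi -> `|s - t| < r -> `|F s - F t| <= e.
  move=> tpi e e0; have /difference_quotientP/(_ 1 ltr01)[r r0 hr] := dF t tpi.
  have K0 : 0 < `|G t| + 1 by have := normr_ge0 (G t); lra.
  exists (Num.min r (e / (`|G t| + 1))).
    by rewrite lt_min r0 divr_gt0.
  move=> s spi; rewrite lt_min ltr_pdivlMr// => /andP[sr se].
  have := hr s spi sr; rewrite mul1r => h.
  have -> : F s - F t = (F s - F t - G t * (s - t)) + G t * (s - t) by ring.
  rewrite (le_trans (ler_normD _ _))// normrM.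
  have := normr_ge0 (s - t); have := normr_ge0 (G t); nra.
(* At an interior point the restriction to [0, pi] is void as soon as |h| < min(t, pi - t), so the
   relative derivative is the ordinary one. *)
have ddF t : 0 < t < pi ->
    (fun h => h^-1 *: (F (h *: (1 : R) + t) - F t)) @ 0^' --> G t.
  move=> /andP[t0 tpi]; apply/cvgrPdist_le => e e0.
  have tt : 0 <= t <= pi by lra.
  have /difference_quotientP/(_ e e0)[r r0 hr] := dF t tt.
  rewrite near_withinE; apply/nbhs_ballP.
  exists (Num.min r (Num.min t (pi - t))) => /=.
    by rewrite !lt_min r0 t0 subr_gt0.
  move=> h; rewrite /ball/= sub0r normrN !lt_min => /and3P[hr1 ht hpi] h0.
  have hh : h *: (1 : R) + t - t = h by rewrite addrK /GRing.scale/= mulr1.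
  have := hr (h *: (1 : R) + t); rewrite hh => /(_ _ hr1).
  rewrite /GRing.scale/= mulr1 => hq.
  have -> : G t - h^-1 * (F (h + t) - F t) = - (h^-1 * (F (h + t) - F t - G t * h)).
    by field.
  rewrite normrN normrM normfV mulrC ler_pdivrMr ?normr_gt0//; apply: hq.
  by move: ht hpi; rewrite !ltr_norml; lra.
have cGx : {within `[0, x], continuous G}.
  by apply: continuous_subspaceW cG; exact: sub_itv_pi.
have Fx : derivable_oo_LRcontinuous F 0 x.
  split.
  - move=> t; rewrite in_itv/= => tx; apply/cvg_ex; exists (G t).
    by apply: ddF; lra.
  - apply/cvgrPdist_le => e e0.
    have [|r r0 hr] := lip 0 _ e e0; first by rewrite lexx ltW.
    rewrite near_withinE; apply/nbhs_ballP; exists (Num.min r pi) => /=.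
      by rewrite lt_min r0 pi0.
    move=> s; rewrite /ball/= sub0r normrN lt_min => /andP[sr spi] s0.
    rewrite distrC; apply: hr; last by rewrite subr0.
    by move: spi; rewrite gtr0_norm//; lra.
  - apply/cvgrPdist_le => e e0.
    have [|r r0 hr] := lip x _ e e0; first by rewrite x0.
    rewrite near_withinE; apply/nbhs_ballP; exists (Num.min r x) => /=.
      by rewrite lt_min r0 xgt0.
    move=> s; rewrite /ball/= lt_min => /andP[sr spi] s0.
    rewrite distrC; apply: hr; last by rewrite distrC.
    by move: spi; rewrite gtr0_norm; lra.
have := @continuous_FTC2 R G F 0 x xgt0 cGx Fx.
rewrite /Rintegral => ->; first by rewrite -EFinD/=; ring.
move=> t; rewrite in_itv/= => tx; rewrite derive1E; apply/cvg_lim => //.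
by apply: ddF; lra.
Qed.

Lemma AC_has_derivative (f g : R -> R[i]) x : AC f g -> ccontinuous g ->
  0 <= x <= pi -> has_derivative f x (g x).
Proof.
move=> [[g1 g2] fE] [cg1 cg2] xpi; split.
- apply: (difference_quotient_integral (F := fun x => Re (f x)) g1) => //.
  by move=> t tpi; rewrite fE// cReD.
- apply: (difference_quotient_integral (F := fun x => Im (f x)) g2) => //.
  by move=> t tpi; rewrite fE// cImD.
Qed.

Lemma has_derivative_AC (f g : R -> R[i]) :
  (forall x, 0 <= x <= pi -> has_derivative f x (g x)) -> ccontinuous g -> AC f g.
Proof.
move=> fg [cg1 cg2]; split.
  by split; apply: continuous_compact_integrable => //; exact: segment_compact.
move=> x xpi; apply: complex_ext; rewrite ?cReD ?cImD/=.
- by apply: (within_FTC2 (F := fun x => Re (f x))) => // t /fg [].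
- by apply: (within_FTC2 (F := fun x => Im (f x))) => // t /fg [].
Qed.

(** The second derivative in [SL_solution] is only some representative satisfying the equation
    almost everywhere; this lemma allows it to be replaced by (q - lambda) y. *)
Lemma AC_ae (f g h : R -> R[i]) : AC f g -> cmeasurable_fun `[0, pi] h ->
  {ae mu, forall x, 0 < x < pi -> g x = h x} -> AC f h.
Proof.
move=> fg [h1 h2] gh; have [[g1 g2] fE] := fg.
(* The hypothesis says nothing at 0 and pi, while the integrals run over closed intervals; the two
   points are discarded as null sets. *)
have ptn (a : R) : {ae mu, forall x, x <> a}.
  exists [set a]; split => //; first by rewrite lebesgue_measure_set1.
  by move=> x /=; rewrite not_notE.
have gh' (P : R[i] -> R) (y : R) : y <= pi -> ae_eq mu `[0, y]%classic (EFin \o (P \o g)) (EFin \o (P \o h)).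
  move=> ypi; have aeF := ae_filter_ringOfSetsType mu.
  apply: (@filterS3 _ _ aeF _ _ _ (fun x => `[0, y]%classic x -> _) _
    gh (ptn 0) (ptn pi)) => x gx x0 xpi /=.
  rewrite in_itv/= => xy.
  rewrite gx//; move/eqP: x0; move/eqP: xpi; rewrite !neq_lt; lra.
have mh1 : measurable_fun (`[0, pi]%classic : set (measurableTypeR R)) (EFin \o (@complex.Re R \o h)).
  by apply/measurable_EFinP.
have mh2 : measurable_fun (`[0, pi]%classic : set (measurableTypeR R)) (EFin \o (@complex.Im R \o h)).
  by apply/measurable_EFinP.
have m1 := measurable_int _ g1; have m2 := measurable_int _ g2.
split.
  split; [move: g1|move: g2] => /integrableP[mg gi]; apply/integrableP; split => //.
  - apply: le_lt_trans gi; rewrite le_eqVlt; apply/orP; left; apply/eqP.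
    apply: esym; apply: ae_eq_integral => //.
    + exact: measurableT_comp mg.
    + exact: measurableT_comp mh1.
    + exact: (ae_eq_abse (gh' (@complex.Re R) pi (lexx _))).
  - apply: le_lt_trans gi; rewrite le_eqVlt; apply/orP; left; apply/eqP.
    apply: esym; apply: ae_eq_integral => //.
    + exact: measurableT_comp mg.
    + exact: measurableT_comp mh2.
    + exact: (ae_eq_abse (gh' (@complex.Im R) pi (lexx _))).
move=> x /andP[x0 xpi]; rewrite fE; last lra.
have sx : `[0, x] `<=` `[(0:R), pi] by exact: sub_itv_pi.
congr (_ + Complex _ _); congr fine; apply: ae_eq_integral => //;
  try exact: (gh' (@complex.Re R)); try exact: (gh' (@complex.Im R)).
- exact: measurable_funS m1.
- exact: measurable_funS mh1.
- exact: measurable_funS m2.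
- exact: measurable_funS mh2.
Qed.

End OneSidedDerivatives.

(** * The exponential e^(c x) with complex c and real x *)

Section ComplexExponential.
Context {R : realType}.
Notation AC := abs_continuous_with.
Implicit Types (c d : R[i]) (x y : R).

Definition cexp c x : R[i] :=
  Complex (expR (Re c * x) * cos (Im c * x)) (expR (Re c * x) * sin (Im c * x)).

Lemma cexp0 c : cexp c 0 = 1.
Proof. by rewrite /cexp !mulr0 expR0 cos0 sin0 !mul1r. Qed.

Lemma cexpD c x y : cexp c (x + y) = cexp c x * cexp c y.
Proof.
apply: complex_ext; rewrite ?cReM ?cImM/= !mulrDr expRD ?cosD ?sinD; ring.
Qed.

Lemma cexpDl c d x : cexp (c + d) x = cexp c x * cexp d x.
Proof.
apply: complex_ext; rewrite ?cReM ?cImM/= cReD cImD !mulrDl expRD ?cosD ?sinD; ring.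
Qed.

Lemma cexpNl c x : cexp (- c) x = cexp c (- x).
Proof. by rewrite /cexp cReN cImN !mulrN !mulNr. Qed.

Lemma cexpK c x : cexp c x * cexp (- c) x = 1.
Proof. by rewrite cexpNl -cexpD subrr cexp0. Qed.

Lemma normc_cexp c x : normc (cexp c x) = expR (Re c * x).
Proof.
apply/eqP; rewrite -(eqrXn2 (n := 2)) ?normc_ge0 ?expR_ge0//.
rewrite sqr_normc/= !exprMn -mulrDr.
by rewrite cos2Dsin2 mulr1.
Qed.

Lemma normc_cexp_le1 c x : Re c <= 0 -> 0 <= x -> normc (cexp c x) <= 1.
Proof.
by move=> c0 x0; rewrite normc_cexp -expR0 ler_expR mulr_le0_ge0.
Qed.

Lemma is_derive_quotient (F : R -> R) x (d : R) : is_derive x 1 F d ->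
  (fun t => (F t - F x) / (t - x)) @ within `[0, pi] x^' --> d.
Proof.
move=> [dF Fd]; apply/difference_quotientP => e e0.
have /cvgrPdist_le/(_ e e0) : (fun h => h^-1 *: ((F \o shift x) (h *: (1 : R)) - F x)) @ 0^' --> d.
  by rewrite -Fd; exact: dF.
rewrite near_withinE => /nbhs_ballP[r /= r0 hr]; exists r => // t _ txr.
have [->|tx] := eqVneq t x; first by rewrite !subrr mulr0 subr0 normr0 mulr0.
have h0 : t - x != 0 by rewrite subr_eq0.
have := hr (t - x); rewrite /ball/= sub0r normrN => /(_ txr h0).
rewrite /shift /GRing.scale/= mulr1 subrK.
have -> : d - (t - x)^-1 * (F t - F x) = - ((F t - F x - d * (t - x)) / (t - x)).
  by field.
by rewrite normrN normrM normfV ler_pdivrMr// normr_gt0.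
Qed.

Lemma cexp_has_derivative c x : has_derivative (cexp c) x (c * cexp c x).
Proof.
have mulderiv (a : R) : is_derive x 1 (fun t => a * t) a.
  have -> : (fun t => a * t) = (a \*: (@id R)) by [].
  by apply: is_derive_eq; rewrite /GRing.scale/= mulr1.
have expd : is_derive x 1 (expR \o (fun t => Re c * t)) (expR (Re c * x) * Re c).
  exact: is_derive1_comp.
have cosd : is_derive x 1 (cos \o (fun t => Im c * t)) (- sin (Im c * x) * Im c).
  exact: is_derive1_comp.
have sind : is_derive x 1 (sin \o (fun t => Im c * t)) (cos (Im c * x) * Im c).
  exact: is_derive1_comp.
split.
- apply: is_derive_quotient.
  have -> : (fun t => Re (cexp c t)) =
    (expR \o (fun t => Re c * t)) * (cos \o (fun t => Im c * t)) by [].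
  by apply: is_derive_eq; rewrite cReM /GRing.scale/=; ring.
- apply: is_derive_quotient.
  have -> : (fun t => Im (cexp c t)) =
    (expR \o (fun t => Re c * t)) * (sin \o (fun t => Im c * t)) by [].
  by apply: is_derive_eq; rewrite cImM /GRing.scale/=; ring.
Qed.

Lemma continuous_cexp c :
  continuous (fun x => Re (cexp c x)) /\ continuous (fun x => Im (cexp c x)).
Proof.
have lin (a : R) : continuous (fun t : R => a * t).
  by move=> x; apply: continuousM; [exact: cst_continuous|].
have ex : continuous (fun t => expR (Re c * t)).
  by move=> x; apply: continuous_comp; [exact: lin|exact: continuous_expR].
have co : continuous (fun t => cos (Im c * t)).
  by move=> x; apply: continuous_comp; [exact: lin|exact: continuous_cos].
have si : continuous (fun t => sin (Im c * t)).
  by move=> x; apply: continuous_comp; [exact: lin|exact: continuous_sin].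
by split=> x; apply: cvgM; first [exact: ex|exact: co|exact: si].
Qed.

Lemma AC_cexp c : AC (cexp c) (fun x => c * cexp c x).
Proof.
apply: has_derivative_AC => [x _|]; first exact: cexp_has_derivative.
have [c1 c2] := continuous_cexp c.
split; apply: continuous_subspaceT => x.
- under eq_fun do rewrite cReM.
  by apply: cvgB; apply: cvgM; first [exact: cvg_cst|exact: c1|exact: c2].
- under eq_fun do rewrite cImM.
  by apply: cvgD; apply: cvgM; first [exact: cvg_cst|exact: c1|exact: c2].
Qed.

End ComplexExponential.

(** * Waves on a single edge *)

Section Edge.
Context {R : realType}.
Notation mu := (@lebesgue_measure R).
Notation AC := abs_continuous_with.
Implicit Types (c : R[i]) (f q y dy : R -> R[i]) (x : R).

Let pi0 : 0 < pi :> R. Proof. exact: pi_gt0. Qed.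

Lemma cmeasurable_oo_cc f : cmeasurable_fun `]0, pi[ f -> cmeasurable_fun `[0, pi] f.
Proof.
move=> [f1 f2]; split.
- exact/measurable_fun_itv_obnd_cbndP/measurable_fun_itv_bndo_bndcP.
- exact/measurable_fun_itv_obnd_cbndP/measurable_fun_itv_bndo_bndcP.
Qed.

Lemma SL_solutionP q (lam : R[i]) y dy : cmeasurable_fun `[0, pi] q ->
  SL_solution q lam y dy -> AC y dy /\ AC dy (fun x => (q x - lam) * y x).
Proof.
move=> mq [hd [d2y [acd eqn]]].
have acy : AC y dy by apply: has_derivative_AC => //; exact: AC_continuous acd.
split => //; apply: AC_ae acd _ _.
  apply: cmeasurableM; last exact: AC_measurable acy.
  by apply: cmeasurableD => //; exact: cmeasurable_cst.
have aeF := ae_filter_ringOfSetsType mu.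
apply: (@filterS _ _ aeF _ _ _ eqn) => x hx /hx /eqP.
by rewrite addrC subr_eq => /eqP h; rewrite mulrBl h; ring.
Qed.

Lemma AC_SL_solution q (lam : R[i]) y dy : AC y dy ->
  AC dy (fun x => (q x - lam) * y x) -> SL_solution q lam y dy.
Proof.
move=> acy acd; split.
  by move=> x; apply: (AC_has_derivative acy); exact: AC_continuous acd.
exists (fun x => (q x - lam) * y x); split => //.
by apply: aeW => x _; ring.
Qed.

(* With c = i rho and lambda = - c^2 = rho^2, the functions dy - c y and dy + c y
   decouple the equation y'' = c^2 y + f. *)
Definition edge_solution c f y dy :=
  AC y dy /\ AC dy (fun x => c ^+ 2 * y x + f x).

Lemma edge_solution_integrable c f y dy : edge_solution c f y dy ->
  cintegrable `[0, pi] f.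
Proof.
move=> [acy [di _]].
apply: (@eq_cintegrable _ _ (fun x => (c ^+ 2 * y x + f x) - c ^+ 2 * y x)) => //.
  by move=> x _; ring.
by apply: cintegrableB => //; apply: cintegrableZ => //; exact: AC_cintegrable acy.
Qed.

(** The wave u = y' - c y satisfies (e^(c x) u)' = e^(c x) f. Integration from x up to pi leaves the
    kernel e^(c (t - x)) with t >= x, of modulus at most 1; this is why u is controlled from the
    right end. *)
Lemma edge_incoming c f y dy x : edge_solution c f y dy -> Re c <= 0 -> 0 <= x <= pi ->
  normc ((dy x - c * y x) - cexp c (pi - x) * (dy pi - c * y pi)) <=
  Rintegral mu `[0, pi] (fun t => normc (f t)).
Proof.
move=> es c0 /andP[x0 xpi]; have fi := edge_solution_integrable es.
have [acy acd] := es; pose u t := dy t - c * y t.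
have acu : AC (fun t => cexp c t * u t) (fun t => cexp c t * f t).
  apply: AC_eq (AC_M (AC_cexp c) (AC_B acd (AC_Z c acy))) _ _ => // t _.
  by rewrite /u; ring.
have inc := AC_increment acu x0 xpi (lexx _).
have eui : cintegrable `[x, pi] (fun t => cexp c t * f t).
  by apply: cintegrable_sub_pi acu.1.
have -> : u x - cexp c (pi - x) * u pi =
    cintegral `[x, pi] (fun t => - cexp (- c) x * (cexp c t * f t)).
  rewrite cintegralZ// -inc cexpD -cexpNl.
  transitivity (cexp c x * cexp (- c) x * u x - cexp c pi * cexp (- c) x * u pi).
    by rewrite cexpK mul1r.
  by ring.
apply: (@le_trans _ _ (Rintegral mu `[x, pi] (fun t => normc (f t)))).
  apply: le_normc_cintegral_bound => //.
  - by apply: cintegrable_measurable; exact: cintegrableZ.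
  - by apply: cintegrable_normc => //; exact: cintegrable_sub_pi fi.
  - move=> t /=; rewrite in_itv/= => /andP[xt _].
    rewrite mulrA Normc.normcM ler_piMl ?normc_ge0// mulNr normcN cexpNl -cexpD.
    by apply: normc_cexp_le1 => //; lra.
apply: Rintegral_sub_le => //; first exact: cintegrable_normc.
by move=> t _; exact: normc_ge0.
Qed.

(** Mirror image for v = y' + c y, controlled from the left end through the kernel e^(c (x - t))
    with t <= x. *)
Lemma edge_outgoing c f y dy x : edge_solution c f y dy -> Re c <= 0 -> 0 <= x <= pi ->
  normc ((dy x + c * y x) - cexp c x * (dy 0 + c * y 0)) <=
  Rintegral mu `[0, pi] (fun t => normc (f t)).
Proof.
move=> es c0 /andP[x0 xpi]; have fi := edge_solution_integrable es.
have [acy acd] := es; pose v t := dy t + c * y t.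
have acv : AC (fun t => cexp (- c) t * v t) (fun t => cexp (- c) t * f t).
  apply: AC_eq (AC_M (AC_cexp (- c)) (AC_D acd (AC_Z c acy))) _ _ => // t _.
  by rewrite /v; ring.
have inc := AC_increment acv (lexx _) x0 xpi.
have evi : cintegrable `[0, x] (fun t => cexp (- c) t * f t).
  by apply: cintegrable_sub_pi acv.1.
have -> : v x - cexp c x * v 0 =
    cintegral `[0, x] (fun t => cexp c x * (cexp (- c) t * f t)).
  rewrite cintegralZ// -inc cexp0.
  transitivity (cexp c x * cexp (- c) x * v x - cexp c x * v 0).
    by rewrite cexpK mul1r.
  by ring.
apply: (@le_trans _ _ (Rintegral mu `[0, x] (fun t => normc (f t)))).
  apply: le_normc_cintegral_bound => //.
  - by apply: cintegrable_measurable; exact: cintegrableZ.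
  - by apply: cintegrable_normc => //; exact: cintegrable_sub_pi fi.
  - move=> t /=; rewrite in_itv/= => /andP[t0 tx].
    rewrite mulrA Normc.normcM ler_piMl ?normc_ge0// cexpNl -cexpD.
    by apply: normc_cexp_le1 => //; lra.
apply: Rintegral_sub_le => //; first exact: cintegrable_normc.
by move=> t _; exact: normc_ge0.
Qed.

Lemma AC_primitive f (a : R[i]) : cintegrable `[0, pi] f ->
  AC (fun x => a + cintegral `[0, x] f) f.
Proof. by move=> fi; split => // x _; rewrite cintegral_itv1 addr0. Qed.

(** [A] and [B] depend on f alone and are chosen before the free amplitudes [U] and [V]. The edge
    thus becomes an affine map from entering to leaving amplitudes, and the boundary value problem
    on the graph becomes linear algebra. *)
Lemma edge_solution_exists c f : c != 0 -> cintegrable `[0, pi] f ->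
  exists A B : R[i], forall U V : R[i], exists y dy,
    [/\ edge_solution c f y dy, dy pi - c * y pi = U, dy 0 + c * y 0 = V,
        dy 0 - c * y 0 = cexp c pi * U - A & dy pi + c * y pi = cexp c pi * V + B].
Proof.
move=> c0 fi.
pose F x := cintegral `[0, x] (fun t => cexp c t * f t).
pose G x := cintegral `[0, x] (fun t => cexp (- c) t * f t).
have ei d : cintegrable `[0, pi] (fun t => cexp d t * f t).
  exact: AC_cintegrableM (AC_cexp d) fi.
exists (F pi), (cexp c pi * G pi) => U V.
pose u x := cexp (- c) x * (cexp c pi * U - F pi + F x).
pose v x := cexp c x * (V + G x).
have acu : AC u (fun x => - c * u x + f x).
  apply: AC_eq (AC_M (AC_cexp (- c)) (AC_primitive (cexp c pi * U - F pi) (ei c))) _ _ => // x _.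
  transitivity (- c * u x + cexp c x * cexp (- c) x * f x).
    by rewrite cexpK mul1r.
  by rewrite /u /F /G; ring.
have acv : AC v (fun x => c * v x + f x).
  apply: AC_eq (AC_M (AC_cexp c) (AC_primitive V (ei (- c)))) _ _ => // x _.
  transitivity (c * v x + cexp c x * cexp (- c) x * f x).
    by rewrite cexpK mul1r.
  by rewrite /v /F /G; ring.
(* This inverts u = y' - c y and v = y' + c y, both found by variation of constants. *)
exists (fun x => (2 * c)^-1 * (v x - u x)), (fun x => 2^-1 * (u x + v x)).
have two0 : (2 : R[i]) != 0 by rewrite pnatr_eq0.
have cy x : c * ((2 * c)^-1 * (v x - u x)) = 2^-1 * (v x - u x) by field; rewrite c0.
have um x : 2^-1 * (u x + v x) - c * ((2 * c)^-1 * (v x - u x)) = u x.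
  by rewrite cy; field.
have vp x : 2^-1 * (u x + v x) + c * ((2 * c)^-1 * (v x - u x)) = v x.
  by rewrite cy; field.
split; rewrite ?um ?vp.
- split.
  + by apply: AC_eq (AC_Z (2 * c)^-1 (AC_B acv acu)) _ _ => // x _; field; rewrite c0.
  + by apply: AC_eq (AC_Z 2^-1 (AC_D acu acv)) _ _ => // x _; field; rewrite c0.
- by rewrite /u subrK mulrA [cexp (- c) _ * _]mulrC cexpK mul1r.
- by rewrite /v /G cintegral_itv1 cexp0 addr0 mul1r.
- by rewrite /u /F cintegral_itv1 cexp0 addr0 mul1r.
- by rewrite /v mulrDr.
Qed.

End Edge.

(** * The linear scattering problem for the amplitudes *)

Section StarScattering.
Context {R : realType} {N : nat}.
Implicit Types (c E W : R[i]) (o i p m s h : 'I_N -> R[i]).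

(** A round trip on an edge multiplies an amplitude by [E ^+ 2]. The denominator [1 + E ^+ 2] occurs
    when solving for the common vertex value, [1 - E ^+ 2] when solving for each single edge. *)
Lemma normc_1DM_ge E : normc E <= 1 / 2 ->
  3 / 4 <= normc (1 + E ^+ 2) /\ 3 / 4 <= normc (1 - E ^+ 2).
Proof.
move=> E2; have E4 : normc (E ^+ 2) <= 1 / 4.
  by rewrite normcX; have := normc_ge0 E; nra.
have := ler_normc_dist 1 (- E ^+ 2); have := ler_normc_dist 1 (E ^+ 2).
rewrite opprK normcN Normc.normc1; lra.
Qed.

(* o and i are the outgoing and incoming amplitudes at the vertex, p and m those
   at the outer ends of the edges. *)
Lemma star_amplitude_le E W o i p m (s K : R) : (0 < N)%N ->
  normc E <= 1 / 2 ->
  (forall j, i j - o j = 2 * W) -> \sum_j (o j + i j) = 0 ->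
  (forall j, normc (p j - m j) <= 2 * s) ->
  (forall j, normc (m j - E * o j) <= K) ->
  (forall j, normc (i j - E * p j) <= K) ->
  forall j, normc (o j) <= 5 * s + 15 / 2 * K /\
            normc (p j) <= 9 / 2 * s + 19 / 4 * K.
Proof.
move=> N0 E2 iow oi0 pm mo ip.
have [E1 E1'] := normc_1DM_ge E2.
(* What returns to the vertex beyond the echo of [o j]: it consists only of the end data and the two
   errors of the edge. *)
pose h j := i j - E ^+ 2 * o j.
have hb j : normc (h j) <= s + 3 / 2 * K.
  have -> : h j = (i j - E * p j) + E * (p j - m j) + E * (m j - E * o j).
    by rewrite /h; ring.
  have h1 := ler_normcD (i j - E * p j + E * (p j - m j)) (E * (m j - E * o j)).
  have h2 := ler_normcD (i j - E * p j) (E * (p j - m j)).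
  rewrite !Normc.normcM in h1 h2.
  have := normc_ge0 E; have := normc_ge0 (p j - m j); have := normc_ge0 (m j - E * o j).
  have := pm j; have := mo j; have := ip j; nra.
have sumo : \sum_j i j = N%:R * W.
  have : \sum_j (o j + i j) = \sum_j (2 * i j - 2 * W).
    by apply: eq_bigr => j _; rewrite -(iow j); ring.
  rewrite oi0 big_split/= -mulr_sumr sumr_const card_ord => h0.
  have : 2 * (\sum_j i j) = 2 * (N%:R * W).
    by apply/eqP; rewrite -subr_eq0 [X in _ == X]h0 -mulr_natl; apply/eqP; ring.
  by apply: mulfI; rewrite pnatr_eq0.
(* Eliminating [o j] gives h = (1 - E^2) i + 2 E^2 W on each edge; summing eliminates the single
   amplitudes and leaves one equation for [W]. *)
have sumh : (1 + E ^+ 2) * (N%:R * W) = \sum_j h j.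
  have -> : \sum_j h j = \sum_j ((1 - E ^+ 2) * i j + 2 * E ^+ 2 * W).
    apply: eq_bigr => j _; have := iow j => /eqP.
    by rewrite subr_eq => /eqP ij; rewrite /h ij; ring.
  rewrite big_split/= -mulr_sumr sumo sumr_const card_ord -mulr_natl; ring.
have s0 : 0 <= s + 3 / 2 * K by apply: le_trans (hb (Ordinal N0)); exact: normc_ge0.
(* Both sides of [sumh] carry a factor N, which cancels, so the bound is independent of the number
   of edges. *)
have Wb : normc W <= 4 / 3 * (s + 3 / 2 * K).
  have : normc (\sum_j h j) <= N%:R * (s + 3 / 2 * K).
    apply: (le_trans (ler_normc_sum _ _ _)).
    apply: (@le_trans _ _ (\sum_(j < N) (s + 3 / 2 * K))); first exact: ler_sum.
    by rewrite sumr_const card_ord -[_ *+ N]mulr_natl lexx.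
  rewrite -sumh !Normc.normcM normc_nat mulrCA ler_pM2l ?ltr0n//.
  have := normc_ge0 W; nra.
move=> j.
have ib : normc (i j) <= 20 / 9 * (s + 3 / 2 * K).
  have ieq : (1 - E ^+ 2) * i j = h j - 2 * E ^+ 2 * W.
    have := iow j => /eqP; rewrite subr_eq => /eqP ij; rewrite /h ij; ring.
  have := ler_normcB (h j) (2 * E ^+ 2 * W).
  rewrite -ieq !Normc.normcM normc_nat => hh.
  have n0 := normc_ge0 E; have n1 := normc_ge0 W; have n2 := normc_ge0 (i j).
  have n3 : normc E * normc E <= 1 / 4 by nra.
  have n4 := hb j; nra.
have ob : normc (o j) <= 44 / 9 * (s + 3 / 2 * K).
  have -> : o j = i j - 2 * W by rewrite -(iow j); ring.
  have := ler_normcB (i j) (2 * W); rewrite Normc.normcM normc_nat; lra.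
split; first by have := normc_ge0 (o j); have := normc_ge0 (i j); lra.
have -> : p j = (p j - m j) + (m j - E * o j) + E * o j by ring.
have h1 := ler_normcD (p j - m j + (m j - E * o j)) (E * o j).
have h2 := ler_normcD (p j - m j) (m j - E * o j).
rewrite Normc.normcM in h1.
have := normc_ge0 E; have := normc_ge0 (o j); have := pm j; have := mo j; nra.
Qed.

(** The elimination of [star_amplitude_le] read backwards: here i - E^2 o equals E (s - A) + B, its
    sum over the edges determines [W], and then each [i j] follows. *)
Lemma star_amplitude_exists E (A B s : 'I_N -> R[i]) : (0 < N)%N ->
  normc E <= 1 / 2 -> exists W o i p m,
  [/\ (forall j, i j - o j = 2 * W), \sum_j (o j + i j) = 0,
      (forall j, p j - m j = s j), (forall j, m j = E * o j - A j) &
      (forall j, i j = E * p j + B j)].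
Proof.
move=> N0 E2.
have [E1 E1'] := normc_1DM_ge E2.
have E10 : 1 + E ^+ 2 != 0.
  by apply/eqP => e0; move: E1; rewrite e0 Normc.normc0; lra.
have E10' : 1 - E ^+ 2 != 0.
  by apply/eqP => e0; move: E1'; rewrite e0 Normc.normc0; lra.
have NN0 : (N%:R : R[i]) != 0 by rewrite pnatr_eq0 -lt0n.
pose h j := E * (s j - A j) + B j.
pose W := (\sum_j h j) / (N%:R * (1 + E ^+ 2)).
pose i j := (h j - 2 * E ^+ 2 * W) / (1 - E ^+ 2).
pose o j := i j - 2 * W.
pose m j := E * o j - A j.
pose p j := m j + s j.
exists W, o, i, p, m; split => //.
- by move=> j; rewrite /o; ring.
- have -> : \sum_j (o j + i j) = \sum_j (2 / (1 - E ^+ 2) * h j - 2 * (1 + E ^+ 2) / (1 - E ^+ 2) * W).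
    by apply: eq_bigr => j _; rewrite /o /i; field.
  rewrite big_split/= -mulr_sumr sumr_const card_ord -mulr_natl /W.
  by field; rewrite NN0 E10 E10'.
- by move=> j; rewrite /p; ring.
- by move=> j; rewrite /p /m /o /i /h; field.
Qed.

End StarScattering.

(** * The forced equation y'' = c^2 y + f on the star *)

Section Star.
Context {R : realType} {N : nat}.
Notation mu := (@lebesgue_measure R).
Notation AC := abs_continuous_with.
Implicit Types (c a : R[i]) (f y dy : 'I_N -> R -> R[i]) (j k : 'I_N).

(* Values and outward fluxes at the inner vertex and at the outer end of an edge:
   edge 1 leaves the vertex at x = 0, the other edges reach it at x = pi. *)
Definition vertex_value y j := if val j == 0%N then y j 0 else y j pi.
Definition end_value y j := if val j == 0%N then y j pi else y j 0.
Definition vertex_flux dy j := if val j == 0%N then - dy j 0 else dy j pi.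
Definition end_flux dy j := if val j == 0%N then - dy j pi else dy j 0.

(** The forcing [f] is arbitrary so that one notion covers Weyl solutions (f = q y), the free
    problem (f = 0) and a Picard step (f = q z). The end value [a] is 1 for Weyl solutions and 0 for
    differences of two of them. *)
Definition star_solution c a k f y dy :=
  [/\ forall j, edge_solution c (f j) (y j) (dy j), matching y dy,
      forall r : 'I_N, val r = 0%N -> y r pi = 0 &
      forall j, val j != 0%N -> y j 0 = a * (j == k)%:R].

Lemma star_matchingP y dy : (0 < N)%N -> matching y dy <->
  (exists Y, forall j, vertex_value y j = Y) /\ \sum_j vertex_flux dy j = 0.
Proof.
move=> N0; pose r0 : 'I_N := Ordinal N0.
have rE j : (val j == 0%N) = (j == r0) by rewrite -val_eqE.
have sumE : \sum_j vertex_flux dy j =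
    - dy r0 0 + \sum_(j < N | val j != 0%N) dy j pi.
  rewrite (bigD1 r0)//= /vertex_flux eqxx; congr (_ + _).
  by apply: eq_big => [j|j /negbTE]; rewrite -rE// => ->.
split=> [/(_ r0 erefl) [h1 h2]|[[Y hY] h2] r r0E].
- split; last by rewrite sumE -h2 addNr.
  exists (y r0 0) => j; rewrite /vertex_value; case: ifPn => [|/h1 <-//].
  by rewrite rE => /eqP ->.
- have -> : r = r0 by apply/eqP; rewrite -rE r0E.
  have y0 := hY r0; rewrite /vertex_value eqxx in y0.
  split=> [j jn|].
    by have := hY j; rewrite /vertex_value (negbTE jn) y0.
  by apply/eqP; rewrite eq_sym -subr_eq0 addrC -sumE h2.
Qed.

Lemma star_solution_end_value c a k f y dy j : val k != 0%N ->
  star_solution c a k f y dy -> end_value y j = a * (j == k)%:R.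
Proof.
move=> k0 [_ _ h1 h2]; rewrite /end_value; case: ifPn => [/eqP jr|/h2 //].
rewrite h1//; case: eqP => [jk|]; last by rewrite mulr0.
by rewrite -jk jr eqxx in k0.
Qed.

(** Reversing edge 1 exchanges, up to sign, the waves u and v, so there the two claims come from
    [edge_incoming] and [edge_outgoing] in the opposite order. *)
Lemma edge_amplitudes c f y dy j K : Re c <= 0 ->
  edge_solution c (f j) (y j) (dy j) ->
  Rintegral mu `[0, pi] (fun t => normc (f j t)) <= K ->
  let E := cexp c pi in
  normc ((end_flux dy j - c * end_value y j) -
         E * (vertex_flux dy j - c * vertex_value y j)) <= K /\
  normc ((vertex_flux dy j + c * vertex_value y j) -
         E * (end_flux dy j + c * end_value y j)) <= K.
Proof.
move=> c0 es fK E.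
have pp : 0 <= (0 : R) <= pi by rewrite lexx pi_ge0.
have pp' : 0 <= (pi : R) <= pi by rewrite lexx pi_ge0.
have h1 := le_trans (edge_incoming es c0 pp) fK; rewrite subr0 in h1.
have h2 := le_trans (edge_outgoing es c0 pp') fK.
rewrite /end_flux /end_value /vertex_flux /vertex_value; case: ifP => _ //.
split.
- rewrite -normcN; apply: le_trans h2; rewrite le_eqVlt; apply/orP; left.
  by apply/eqP; congr normc; rewrite /E; ring.
- rewrite -normcN; apply: le_trans h1; rewrite le_eqVlt; apply/orP; left.
  by apply/eqP; congr normc; rewrite /E; ring.
Qed.

Lemma star_amplitudes c a k f y dy (s K : R) : (0 < N)%N -> val k != 0%N ->
  Re c <= 0 -> normc (cexp c pi) <= 1 / 2 ->
  star_solution c a k f y dy -> normc a <= s ->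
  (forall j, Rintegral mu `[0, pi] (fun t => normc (f j t)) <= K) ->
  forall j, normc (dy j pi - c * y j pi) <= 5 * (normc c * s) + 15 / 2 * K /\
            normc (dy j 0 + c * y j 0) <= 5 * (normc c * s) + 15 / 2 * K.
Proof.
move=> N0 k0 c0 E2 ss as_ fK.
have [es mt _ _] := ss; have [[Y hY] sumD] := (star_matchingP y dy N0).1 mt.
have K0 : 0 <= K.
  apply: le_trans (fK (Ordinal N0)); apply: Rintegral_ge0 => t _; exact: normc_ge0.
have s0 : 0 <= normc c * s.
  by rewrite mulr_ge0 ?normc_ge0//; exact: le_trans (normc_ge0 a) as_.
pose o j := vertex_flux dy j - c * vertex_value y j.
pose i j := vertex_flux dy j + c * vertex_value y j.
pose m j := end_flux dy j - c * end_value y j.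
pose p j := end_flux dy j + c * end_value y j.
have io j : i j - o j = 2 * (c * Y) by rewrite /i /o hY; ring.
have sumoi : \sum_j (o j + i j) = 0.
  transitivity (\sum_j (2 * vertex_flux dy j)); last by rewrite -mulr_sumr sumD mulr0.
  by apply: eq_bigr => j _; rewrite /i /o; ring.
have pmb j : normc (p j - m j) <= 2 * (normc c * s).
  have -> : p j - m j = 2 * c * end_value y j by rewrite /p /m; ring.
  rewrite (star_solution_end_value _ k0 ss) !Normc.normcM normc_nat -mulrA.
  rewrite ler_pM2l// ler_wpM2l ?normc_ge0//; case: (j == k).
    by rewrite mulr1n Normc.normc1 mulr1.
  by rewrite mulr0n Normc.normc0 mulr0; exact: le_trans (normc_ge0 a) as_.
have mo j : normc (m j - cexp c pi * o j) <= K.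
  exact: (edge_amplitudes c0 (es j) (fK j)).1.
have ip j : normc (i j - cexp c pi * p j) <= K.
  exact: (edge_amplitudes c0 (es j) (fK j)).2.
move=> j; have [ob pb] := star_amplitude_le N0 E2 io sumoi pmb mo ip j.
have pb' : normc (p j) <= 5 * (normc c * s) + 15 / 2 * K by lra.
move: ob pb'; rewrite /o /p /vertex_flux /vertex_value /end_flux /end_value.
case: ifP => _ // ob pb'; split.
- rewrite -normcN; apply: le_trans pb'; rewrite le_eqVlt; apply/orP; left.
  by apply/eqP; congr normc; ring.
- rewrite -normcN; apply: le_trans ob; rewrite le_eqVlt; apply/orP; left.
  by apply/eqP; congr normc; ring.
Qed.

(** As 2 c y is the difference of the waves v and u, each bounded by an amplitude plus K, one gets 2
    |c| |y| <= 2 (5 |c| s + 15/2 K) + 2 K. The gain of 1 / |c| on the forcing makes the potential a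
    small perturbation far from rho = 0. *)
Lemma star_solution_le c a k f y dy (s K : R) : (0 < N)%N -> val k != 0%N ->
  c != 0 -> Re c <= 0 -> normc (cexp c pi) <= 1 / 2 ->
  star_solution c a k f y dy -> normc a <= s ->
  (forall j, Rintegral mu `[0, pi] (fun t => normc (f j t)) <= K) ->
  forall j x, 0 <= x <= pi -> normc (y j x) <= 5 * s + 17 / 2 * K / normc c.
Proof.
move=> N0 k0 cn0 c0 E2 ss as_ fK j x xpi; have [es _ _ _] := ss.
have [b1 b2] := star_amplitudes N0 k0 c0 E2 ss as_ fK j.
have h1 := le_trans (edge_incoming (es j) c0 xpi) (fK j).
have h2 := le_trans (edge_outgoing (es j) c0 xpi) (fK j).
have e1 : normc (cexp c (pi - x)) <= 1 by apply: normc_cexp_le1 => //; lra.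
have e2 : normc (cexp c x) <= 1 by apply: normc_cexp_le1 => //; lra.
have cgt : 0 < normc c.
  rewrite lt_neqAle normc_ge0 andbT; apply: contra_neq cn0 => /esym.
  exact: Normc.eq0_normc.
have : 2 * normc c * normc (y j x) <= 10 * (normc c * s) + 17 * K.
  have -> : 2 * normc c * normc (y j x) = normc (2 * c * y j x).
    by rewrite !Normc.normcM normc_nat.
  have -> : 2 * c * y j x =
     ((dy j x + c * y j x) - cexp c x * (dy j 0 + c * y j 0)) -
     ((dy j x - c * y j x) - cexp c (pi - x) * (dy j pi - c * y j pi)) +
     (cexp c x * (dy j 0 + c * y j 0) - cexp c (pi - x) * (dy j pi - c * y j pi)).
    by ring.
  apply: (le_trans (ler_normcD _ _)).
  apply: (le_trans (lerD (ler_normcB _ _) (ler_normcB _ _))).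
  rewrite [normc (cexp c x * _)]Normc.normcM [normc (cexp c (pi - x) * _)]Normc.normcM.
  have := normc_ge0 (dy j pi - c * y j pi); have := normc_ge0 (dy j 0 + c * y j 0).
  have := normc_ge0 (cexp c x); have := normc_ge0 (cexp c (pi - x)); nra.
move=> h; have c20 : 0 < 2 * normc c by rewrite mulr_gt0.
rewrite -(ler_pM2l c20); apply: (le_trans h); rewrite le_eqVlt; apply/orP; left.
by apply/eqP; field; rewrite gt_eqF.
Qed.

Lemma star_solution_exists c a k f : (0 < N)%N -> val k != 0%N ->
  c != 0 -> normc (cexp c pi) <= 1 / 2 ->
  (forall j, cintegrable `[0, pi] (f j)) ->
  exists y dy, star_solution c a k f y dy.
Proof.
move=> N0 k0 c0 E2 fi.
have edge j : exists A B : R[i], forall o p, exists y dy : R -> R[i],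
    edge_solution c (f j) y dy /\
    [/\ vertex_flux (fun=> dy) j - c * vertex_value (fun=> y) j = o,
        end_flux (fun=> dy) j + c * end_value (fun=> y) j = p,
        end_flux (fun=> dy) j - c * end_value (fun=> y) j = cexp c pi * o - A &
        vertex_flux (fun=> dy) j + c * vertex_value (fun=> y) j = cexp c pi * p + B].
  have [A [B h]] := edge_solution_exists c0 (fi j).
  (* On the reversed edge 1 the free amplitudes enter as -p at pi and -o at 0, and [A] and [B]
     change places. *)
  rewrite /vertex_flux /vertex_value /end_flux /end_value; case: (val j == 0%N).
    exists B, A => o p; have [y [dy [es h1 h2 h3 h4]]] := h (- p) (- o).
    exists y, dy; split => //; split.
    - by rewrite -(opprK o) -h2; ring.
    - by rewrite -(opprK p) -h1; ring.
    - by apply: oppr_inj; rewrite -[RHS]/(- (_ - _)) !opprB opprK [LHS]addrC h4; ring.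
    - by apply: oppr_inj; rewrite opprD opprK h3; ring.
  exists A, B => o p; have [y [dy [es h1 h2 h3 h4]]] := h o p.
  by exists y, dy.
have [A hA] := choice edge; have [B hB] := choice hA.
(* The prescribed end value appears as the jump p - m, which is 2 c times that value. *)
have [W [oo [ii [p [m [h1 h2 h3 h4 h5]]]]]] :=
  star_amplitude_exists A B (fun j => 2 * c * (a * (j == k)%:R)) N0 E2.
have [y hy] := choice (fun j => hB j (oo j) (p j)).
have [dy hdy] := choice hy.
have two0 : (2 : R[i]) != 0 by rewrite pnatr_eq0.
have ends j : end_value y j = a * (j == k)%:R.
  have [_ [_ e1 e2 _]] := hdy j.
  have : 2 * c * end_value y j = 2 * c * (a * (j == k)%:R).
    rewrite -h3 h4 -e2 -e1 /end_value /end_flux; case: ifP => _; ring.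
  by apply: mulfI; rewrite mulf_neq0.
have vv j : vertex_value y j = c^-1 * W.
  have [_ [e1 _ _ e2]] := hdy j.
  have : 2 * c * vertex_value y j = 2 * c * (c^-1 * W).
    have -> : 2 * c * (c^-1 * W) = 2 * W by field.
    rewrite -(h1 j) h5 -e2 -e1.
    rewrite /vertex_value /vertex_flux; case: ifP => _; ring.
  by apply: mulfI; rewrite mulf_neq0.
exists y, dy; split.
- by move=> j; have [] := hdy j.
- apply/star_matchingP => //; split; first by exists (c^-1 * W).
  have : 2 * \sum_j vertex_flux dy j = 0.
    rewrite mulr_sumr; transitivity (\sum_j (oo j + ii j)) => //.
    apply: eq_bigr => j _.
    have [_ [e1 _ _ e2]] := hdy j; rewrite h5 -e2 -e1.
    by rewrite /vertex_value /vertex_flux; case: ifP => _; ring.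
  by move/eqP; rewrite mulf_eq0 (negbTE two0)/= => /eqP.
- move=> r r0; have := ends r; rewrite /end_value r0 eqxx => ->.
  case: eqP => [rk|]; last by rewrite mulr0.
  by rewrite -rk r0 eqxx in k0.
- by move=> j j0; have := ends j; rewrite /end_value (negbTE j0).
Qed.

End Star.

(** * Limits of sequences with geometrically small steps *)

Section GeometricLimit.
Context {R : realType}.

(** The intervals of centre a n and radius 2 C / 2^n are nested, since the radius drops by exactly C
    / 2^n; the limit is the supremum of their left ends. *)
Lemma real_geometric_limit (a : nat -> R) (C : R) :
  (forall n, `|a n.+1 - a n| <= C / 2 ^+ n) ->
  exists l, forall n, `|l - a n| <= 2 * C / 2 ^+ n.
Proof.
move=> aC.
pose lo n := a n - 2 * C / 2 ^+ n; pose up n := a n + 2 * C / 2 ^+ n.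
have half n : 2 * C / 2 ^+ n.+1 = C / 2 ^+ n.
  by rewrite exprS; field; rewrite expf_neq0.
have dbl n : 2 * C / 2 ^+ n = C / 2 ^+ n + C / 2 ^+ n.
  by rewrite -mulrA mulr_natl mulr2n.
have loS n : lo n <= lo n.+1.
  by have := aC n; rewrite /lo half dbl ler_norml; lra.
have upS n : up n.+1 <= up n.
  by have := aC n; rewrite /up half dbl ler_norml; lra.
have loD n d : lo n <= lo (n + d)%N.
  by elim: d => [|d ih]; rewrite ?addn0// addnS (le_trans ih).
have upD n d : up (n + d)%N <= up n.
  by elim: d => [|d ih]; rewrite ?addn0// addnS (le_trans _ ih).
have lu n : lo n <= up n.
  by have := aC n; have := normr_ge0 (a n.+1 - a n); rewrite /lo /up dbl; lra.
have loup n m : lo n <= up m.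
  rewrite (le_trans (loD n m))// (le_trans (lu _))// addnC; exact: upD.
have sl : has_sup (range lo).
  by split; [exists (lo 0%N); exists 0%N|exists (up 0%N) => _ [n _ <-]].
exists (sup (range lo)) => n; rewrite ler_distl; apply/andP; split.
- by apply: sup_upper_bound => //; exists n.
- by apply: sup_le_ub; [exact: sl.1|move=> _ [m _ <-]; exact: loup].
Qed.

Lemma complex_geometric_limit (z : nat -> R[i]) (C : R) :
  (forall n, normc (z n.+1 - z n) <= C / 2 ^+ n) ->
  exists l, forall n, normc (l - z n) <= 4 * C / 2 ^+ n.
Proof.
move=> zC.
have [lr hr] : exists l, forall n, `|l - Re (z n)| <= 2 * C / 2 ^+ n.
  apply: real_geometric_limit => n; apply: le_trans (zC n).
  by rewrite -cReN -cReD ler_Re_normc.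
have [li hi] : exists l, forall n, `|l - Im (z n)| <= 2 * C / 2 ^+ n.
  apply: real_geometric_limit => n; apply: le_trans (zC n).
  by rewrite -cImN -cImD ler_Im_normc.
exists (Complex lr li) => n; apply: (le_trans (normc_le_ReIm _)).
rewrite cReD cReN cImD cImN/= (_ : 4 * C / _ = 2 * C / 2 ^+ n + 2 * C / 2 ^+ n).
  exact: lerD.
by rewrite -mulrDl; congr (_ / _); lra.
Qed.

Lemma geometric_bound_cvg (u : nat -> R) (l C : R) :
  (forall n, `|l - u n| <= C / 2 ^+ n) -> u @ \oo --> l.
Proof.
move=> uC; apply/cvgrPdist_le => e e0.
have C0 : 0 <= C by have := le_trans (normr_ge0 _) (uC 0%N); rewrite expr0 divr1.
exists (Num.bound (C / e)) => // n /= Bn; apply: (le_trans (uC n)).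
rewrite ler_pdivrMr ?exprn_gt0// mulrC -ler_pdivrMr//.
apply: (@le_trans _ _ (Num.bound (C / e))%:R).
  by apply: ltW; apply: archi_boundP; apply: divr_ge0 => //; exact: ltW.
by rewrite -natrX ler_nat (leq_trans Bn)// ltnW// ltn_expl.
Qed.

End GeometricLimit.

(** * The equation with potential: a priori bound and Picard iteration *)

Section StarPotential.
Context {R : realType} {N : nat}.
Notation mu := (@lebesgue_measure R).
Notation AC := abs_continuous_with.
Implicit Types (c a : R[i]) (f y dy : 'I_N -> R -> R[i]) (j k : 'I_N).

Lemma star_solutionB c a1 a2 k f1 f2 y1 y2 dy1 dy2 :
  star_solution c a1 k f1 y1 dy1 -> star_solution c a2 k f2 y2 dy2 ->
  star_solution c (a1 - a2) k (fun j x => f1 j x - f2 j x)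
    (fun j x => y1 j x - y2 j x) (fun j x => dy1 j x - dy2 j x).
Proof.
move=> [e1 m1 p1 b1] [e2 m2 p2 b2]; split.
- move=> j; have [h1 h2] := e1 j; have [h3 h4] := e2 j; split; first exact: AC_B.
  by apply: AC_eq (AC_B h2 h4) _ _ => // x _; ring.
- move=> r r0; have [v1 d1] := m1 r r0; have [v2 d2] := m2 r r0; split.
    by move=> j jn; rewrite (v1 _ jn) (v2 _ jn).
  by rewrite d1 d2 -sumrB.
- by move=> r r0; rewrite p1// p2// subrr.
- by move=> j jn; rewrite b1// b2//; ring.
Qed.

Lemma star_solution_eq c a k f1 f2 y dy :
  (forall j x, 0 <= x <= pi -> f2 j x = f1 j x) ->
  star_solution c a k f1 y dy -> star_solution c a k f2 y dy.
Proof.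
move=> ff [es m p b]; split => // j; have [h1 h2] := es j; split => //.
by apply: AC_eq h2 _ _ => // x xpi; rewrite ff.
Qed.

Lemma Rintegral_normcM_le (q z : R -> R[i]) (Q B : R) :
  cintegrable `[0, pi] q -> cmeasurable_fun `[0, pi] z ->
  Rintegral mu `[0, pi] (fun t => normc (q t)) <= Q ->
  (forall x, 0 <= x <= pi -> normc (z x) <= B) ->
  Rintegral mu `[0, pi] (fun t => normc (q t * z t)) <= Q * B.
Proof.
move=> qi mz qQ zB.
have B0 : 0 <= B.
  by apply: le_trans (zB 0 _); rewrite ?normc_ge0// lexx pi_ge0.
have nq := cintegrable_normc (measurable_itv `[0, pi]) qi.
apply: (@le_trans _ _ (B * Rintegral mu `[0, pi] (fun t => normc (q t)))); last first.
  by rewrite mulrC ler_wpM2r.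
rewrite -RintegralZl//; apply: le_Rintegral => //.
- apply: cintegrable_normc => //.
  apply: (@eq_cintegrable _ _ (fun x => z x * q x)) => //.
    by move=> x _; exact: mulrC.
  by apply: (cintegrableMl _ mz) => // x /=; rewrite in_itv/=; exact: zB.
- exact: integrable_EFinZ.
- move=> x /=; rewrite in_itv/= => xpi.
  by rewrite Normc.normcM mulrC ler_wpM2r ?normc_ge0 ?zB.
Qed.

Variables (c : R[i]) (k : 'I_N) (q : 'I_N -> R -> R[i]) (Q : R).
Hypotheses (N0 : (0 < N)%N) (k0 : val k != 0%N) (c0 : c != 0) (Rec : Re c <= 0)
  (E2 : normc (cexp c pi) <= 1 / 2)
  (qi : forall j, cintegrable `[0, pi] (q j))
  (qQ : forall j, Rintegral mu `[0, pi] (fun t => normc (q j t)) <= Q)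
  (Qc : 17 / 2 * Q / normc c <= 1 / 2).

Lemma cintegrable_potentialM (z : R -> R[i]) (B : R) j : cmeasurable_fun `[0, pi] z ->
  (forall x, 0 <= x <= pi -> normc (z x) <= B) ->
  cintegrable `[0, pi] (fun x => q j x * z x).
Proof.
move=> mz zB; apply: (@eq_cintegrable _ _ (fun x => z x * q j x)) => //.
  by move=> x _; exact: mulrC.
by apply: (cintegrableMl _ mz) => // x /=; rewrite in_itv/=; exact: zB.
Qed.

(** The contraction: the forcing q z has L1 norm at most Q B on each edge, and [Qc] turns its
    contribution 17/2 Q B / |c| into at most B / 2. *)
Lemma star_step_le a y dy z (s B : R) : normc a <= s ->
  (forall j, cmeasurable_fun `[0, pi] (z j)) ->
  (forall j x, 0 <= x <= pi -> normc (z j x) <= B) ->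
  star_solution c a k (fun j x => q j x * z j x) y dy ->
  forall j x, 0 <= x <= pi -> normc (y j x) <= 5 * s + B / 2.
Proof.
move=> as_ mz zB ss j x xpi.
have h := star_solution_le N0 k0 c0 Rec E2 ss as_
  (fun j => Rintegral_normcM_le (qi j) (mz j) (qQ j) (zB j)).
apply: (le_trans (h j x xpi)); rewrite lerD2l.
have B0 : 0 <= B by apply: le_trans (zB j x xpi); exact: normc_ge0.
have -> : 17 / 2 * (Q * B) / normc c = 17 / 2 * Q / normc c * B by ring.
by apply: (le_trans (ler_wpM2r B0 Qc)); lra.
Qed.

(** The solution is its own Picard image, so its supremum S satisfies S <= 5 |a| + S / 2. Absolute
    continuity is used first to know that S is finite. *)
Lemma star_potential_le a y dy :
  star_solution c a k (fun j x => q j x * y j x) y dy ->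
  forall j x, 0 <= x <= pi -> normc (y j x) <= 10 * normc a.
Proof.
move=> ss; have [es _ _ _] := ss.
pose A := [set t | exists j x, 0 <= x <= pi /\ t = normc (y j x)].
have pp : 0 <= (0 : R) <= pi by rewrite lexx pi_ge0.
pose b j := normc (y j 0) + Rintegral mu `[0, pi] (fun t => normc (dy j t)).
have yb j x : 0 <= x <= pi -> normc (y j x) <= b j.
  by move=> xpi; apply: (AC_bounded (es j).1).
have sA : has_sup A.
  split; first by exists (normc (y k 0)), k, 0.
  exists (\sum_j b j) => _ [j [x [xpi ->]]].
  apply: (le_trans (yb j x xpi)); rewrite (bigD1 j)//= lerDl; apply: sumr_ge0 => i _.
  exact: le_trans (normc_ge0 _) (yb i 0 pp).
have yS j x : 0 <= x <= pi -> normc (y j x) <= sup A.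
  by move=> xpi; apply: sup_upper_bound => //; exists j, x.
have : sup A <= 5 * normc a + sup A / 2.
  apply: sup_le_ub; first exact: sA.1.
  move=> _ [j [x [xpi ->]]]; apply: (star_step_le (lexx _) _ yS ss) => //.
  by move=> i; exact: AC_measurable (es i).1.
by move=> h j x /(yS j) hy; lra.
Qed.

(** Picard iteration from 0 in the supremum norm over all edges; successive iterates differ by at
    most 5 |a| / 2^n. *)
Lemma star_potential_exists a : exists y dy,
  star_solution c a k (fun j x => q j x * y j x) y dy.
Proof.
(* Iterates carry their absolute continuity, which makes q z integrable; thus a successor exists for
   every element of [T] and [choice] yields a function to iterate. *)
pose T := {yd : ('I_N -> R -> R[i]) * ('I_N -> R -> R[i]) | forall j, AC (yd.1 j) (yd.2 j)}.
have step (z : T) : exists z' : T,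
    star_solution c a k (fun j x => q j x * (sval z).1 j x) (sval z').1 (sval z').2.
  case: z => -[y dy] /= acz.
  have [y' [dy' ss]] : exists y' dy', star_solution c a k (fun j x => q j x * y j x) y' dy'.
    apply: star_solution_exists => // j.
    apply: cintegrable_potentialM; first exact: AC_measurable (acz j).
    by move=> x; exact: (AC_bounded (acz j)).
  have ac' j : AC (y' j) (dy' j) by have [es _ _ _] := ss; exact: (es j).1.
  by exists (exist _ (y', dy') ac').
have [g hg] := choice step.
pose zero : 'I_N -> R -> R[i] := fun _ _ => 0.
have ac0 j : AC ((zero, zero).1 j) ((zero, zero).2 j) by exact: AC_cst.
pose z n : T := iter n g (exist _ (zero, zero) ac0).
pose Y n := (sval (z n)).1; pose dY n := (sval (z n)).2.
have acY n j : AC (Y n j) (dY n j) by exact: (svalP (z n) j).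
have mY n j : cmeasurable_fun `[0, pi] (Y n j) by exact: AC_measurable (acY n j).
have ssY n : star_solution c a k (fun j x => q j x * Y n j x) (Y n.+1) (dY n.+1).
  exact: hg.
pose C := 5 * normc a.
have YC n : forall j x, 0 <= x <= pi -> normc (Y n.+1 j x - Y n j x) <= C / 2 ^+ n.
  elim: n => [|n ih] j x xpi.
    rewrite expr0 divr1 /Y/= subr0.
    have := @star_step_le a (Y 1%N) (dY 1%N) (Y 0%N) (normc a) 0 (lexx _) (mY 0%N) _ (ssY 0%N) j x xpi.
    rewrite mul0r addr0; apply => i t _.
    by rewrite (_ : Y 0%N i t = 0)// Normc.normc0.
  have ss' := star_solutionB (ssY n.+1) (ssY n).
  rewrite subrr in ss'.
  have := @star_step_le 0 _ _ (fun j x => Y n.+1 j x - Y n j x) 0 (C / 2 ^+ n) _ _ ih.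
  rewrite Normc.normc0 => /(_ (fun j x => Y n.+2 j x - Y n.+1 j x) (fun j x => dY n.+2 j x - dY n.+1 j x) (lexx _)) h.
  have -> : C / 2 ^+ n.+1 = 5 * 0 + C / 2 ^+ n / 2.
    by rewrite exprS; field; rewrite expf_neq0.
  apply: h => //.
    by move=> i; apply: cmeasurableD => //; exact: cmeasurableN.
  by apply: star_solution_eq ss' => i t _; rewrite mulrBr.
have lim (jx : 'I_N * R) : exists l : R[i], 0 <= jx.2 <= pi ->
    forall n, normc (l - Y n jx.1 jx.2) <= 4 * C / 2 ^+ n.
  case: jx => j x /=; have [xpi|] := boolP (0 <= x <= pi); last by exists 0.
  by have [l hl] := complex_geometric_limit (fun n => YC n j x xpi); exists l.
have [L' hL'] := choice lim; pose L j x := L' (j, x).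
have hL j x n : 0 <= x <= pi -> normc (L j x - Y n j x) <= 4 * C / 2 ^+ n.
  by move=> xpi; exact: (hL' (j, x)).
have mL j : cmeasurable_fun `[0, pi] (L j).
  split; apply: measurable_fun_cvg.
  - by move=> n; exact: (mY n j).1.
  - move=> x /=; rewrite in_itv/= => xpi.
    apply: (@geometric_bound_cvg _ _ _ (4 * C)) => n; apply: le_trans (hL j x n xpi).
    by rewrite -cReN -cReD ler_Re_normc.
  - by move=> n; exact: (mY n j).2.
  - move=> x /=; rewrite in_itv/= => xpi.
    apply: (@geometric_bound_cvg _ _ _ (4 * C)) => n; apply: le_trans (hL j x n xpi).
    by rewrite -cImN -cImD ler_Im_normc.
have bL j x : 0 <= x <= pi -> normc (L j x) <= 4 * C.
  by move=> xpi; have := hL j x 0%N xpi; rewrite expr0 divr1 /Y/= subr0.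
(* At this point [L] is only known to be a bounded measurable pointwise limit. One more step with
   forcing q L produces an absolutely continuous [y], which is then shown to equal [L]. *)
have [y [dy ss]] : exists y dy, star_solution c a k (fun j x => q j x * L j x) y dy.
  by apply: star_solution_exists => // j; exact: cintegrable_potentialM (bL j).
exists y, dy; apply: (star_solution_eq _ ss) => j x xpi; congr (_ * _).
apply/eqP; rewrite -subr_eq0; apply/eqP/Normc.eq0_normc/eqP.
(* Both [y] and [L] lie within 2 C / 2^n of the iterate n + 1: the former by contraction, the latter
   by the rate of convergence. *)
rewrite eq_le normc_ge0 andbT; apply: (@le0_geometric _ _ (4 * C)) => n.
have ss' := star_solutionB ss (ssY n); rewrite subrr in ss'.
have h1 := hL j x n.+1 xpi.
have h2 : normc (y j x - Y n.+1 j x) <= 5 * 0 + 4 * C / 2 ^+ n / 2.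
  apply: (@star_step_le 0 (fun j x => y j x - Y n.+1 j x)
    (fun j x => dy j x - dY n.+1 j x) (fun j x => L j x - Y n j x)) => //.
  - by rewrite Normc.normc0.
  - by move=> i; apply: cmeasurableD => //; exact: cmeasurableN.
  - by move=> i t tpi; exact: hL.
  - by apply: star_solution_eq ss' => i t _; rewrite mulrBr.
have -> : y j x - L j x = (y j x - Y n.+1 j x) - (L j x - Y n.+1 j x) by ring.
apply: (le_trans (ler_normcB _ _)); apply: (le_trans (lerD h2 h1)).
by rewrite exprS le_eqVlt; apply/orP; left; apply/eqP; field; rewrite expf_neq0.
Qed.

End StarPotential.

(** * Square integrable functions on [0, pi] *)

Section SquareIntegrable.
Context {R : realType}.
Notation mu := (@lebesgue_measure R).
Implicit Types (g h : R -> R[i]).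

Definition square_integrable g := cmeasurable_fun `[0, pi] g /\
  mu.-integrable `[0, pi] (EFin \o (fun x => normc (g x) ^+ 2)).

Lemma Rintegral_cst_pi (k : R) : Rintegral mu `[0, pi] (fun=> k) = k * pi.
Proof.
rewrite Rintegral_cst//= lebesgue_measure_itv/= lte_fin pi_gt0.
by rewrite -EFinD/= subr0.
Qed.

Lemma square_integrable_integrable g : square_integrable g -> cintegrable `[0, pi] g.
Proof.
move=> [mg gi].
apply: (@cintegrable_le _ _ _ (fun x => 1 + normc (g x) ^+ 2)) => //.
  by apply: integrable_EFinD => //; exact: integrable_cst_itv.
by move=> x _; have := normc_ge0 (g x); nra.
Qed.

Lemma square_integrable_le g h (C : R) : cmeasurable_fun `[0, pi] h ->
  (forall x, 0 <= x <= pi -> normc (h x) <= C * normc (g x)) ->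
  square_integrable g -> square_integrable h.
Proof.
move=> mh hg [mg gi]; split => //.
apply: (@le_integrable _ _ _ mu _ _ _ (EFin \o (fun x => C ^+ 2 * normc (g x) ^+ 2))) => //.
- apply/measurable_EFinP; apply: measurable_funX.
  exact: (cmeasurable_normc mh).
- move=> x /=; rewrite in_itv/= => xpi.
  rewrite lee_fin [leLHS]ger0_norm ?sqr_ge0//.
  rewrite [leRHS]ger0_norm; last by rewrite mulr_ge0 ?sqr_ge0.
  have hx := hg x xpi; have n0 := normc_ge0 (h x).
  by apply: (le_trans (ler_pM n0 n0 hx hx)); rewrite mulrACA.
- exact: integrable_EFinZ.
Qed.

Lemma square_integrableD g h : square_integrable g -> square_integrable h ->
  square_integrable (fun x => g x + h x).
Proof.
move=> [mg gi] [mh hi]; have mgh := cmeasurableD mg mh; split => //.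
apply: (@le_integrable _ _ _ mu _ _ _
  (EFin \o (fun x => 2 * normc (g x) ^+ 2 + 2 * normc (h x) ^+ 2))) => //.
- by apply/measurable_EFinP; apply: measurable_funX; exact: (cmeasurable_normc mgh).
- move=> x _ /=; rewrite lee_fin [leLHS]ger0_norm ?sqr_ge0//.
  rewrite [leRHS]ger0_norm; last first.
    by apply: addr_ge0; apply: mulr_ge0 => //; exact: sqr_ge0.
  have h1 := ler_normcD (g x) (h x); have n0 := normc_ge0 (g x + h x).
  apply: (le_trans (ler_pM n0 n0 h1 h1)).
  rewrite -subr_ge0 (_ : _ - _ = (normc (g x) - normc (h x)) ^+ 2) ?sqr_ge0//.
  by ring.
- by apply: integrable_EFinD => //; exact: integrable_EFinZ.
Qed.

(* Integrating (|g| - m)^2 >= 0 with m the mean of |g|. *)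
Lemma sqr_Rintegral_normc_le g : square_integrable g ->
  Rintegral mu `[0, pi] (fun x => normc (g x)) ^+ 2 <=
  pi * Rintegral mu `[0, pi] (fun x => normc (g x) ^+ 2).
Proof.
move=> g2; have gi := square_integrable_integrable g2.
have ni := cintegrable_normc (measurable_itv `[0, pi]) gi.
set S := Rintegral _ _ _.
have p0 : 0 < pi :> R by exact: pi_gt0.
pose m := S / pi.
have i1 : mu.-integrable `[0, pi] (EFin \o (fun x => (2 * m) * normc (g x))).
  exact: integrable_EFinZ.
have i2 : mu.-integrable `[0, pi] (EFin \o (fun x => normc (g x) ^+ 2 + m ^+ 2)).
  by apply: integrable_EFinD => //; [exact: g2.2|exact: integrable_cst_itv].
have : 2 * m * S <= Rintegral mu `[0, pi] (fun x => normc (g x) ^+ 2) + m ^+ 2 * pi.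
  rewrite /S -RintegralZl// -Rintegral_cst_pi -RintegralD//; last 2 first.
  - exact: g2.2.
  - exact: integrable_cst_itv.
  apply: le_Rintegral => // x _; have := sqr_ge0 (normc (g x) - m); nra.
have Sm : S = m * pi by rewrite /m divfK// gt_eqF.
rewrite Sm; nra.
Qed.

End SquareIntegrable.

(** * Bessel's inequality on [0, pi] *)

Section Bessel.
Context {R : realType}.
Notation mu := (@lebesgue_measure R).
Implicit Types (g : R -> R[i]) (s t x : R).

(** This is e^(2 i s x). The factor 2 matches the square of the free solution, and it makes integer
    values of s orthogonal on an interval of length pi. *)
Definition osc s x : R[i] := cexp (Complex 0 (2 * s)) x.

Definition fourier g s := cintegral `[0, pi] (fun x => g x * osc s x).

Lemma normc_osc s x : normc (osc s x) = 1.
Proof. by rewrite normc_cexp mul0r expR0. Qed.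

Lemma oscD s t x : osc (s + t) x = osc s x * osc t x.
Proof.
rewrite /osc -cexpDl; congr (cexp _ x).
by apply: complex_ext; rewrite /= ?addr0 ?mulrDr.
Qed.

Lemma osc0 x : osc 0 x = 1.
Proof.
by rewrite /osc /cexp/= mulr0 mul0r expR0 cos0 sin0 mul1r mulr0.
Qed.

Lemma conjc_osc s x : conjc (osc (- s) x) = osc s x.
Proof.
rewrite /osc /cexp/= (_ : 2 * - s * x = - (2 * s * x)); last by ring.
by rewrite cosN sinN mulrN opprK.
Qed.

Lemma conjcM (a b : R[i]) : conjc (a * b) = conjc a * conjc b.
Proof. by case: a => u v; case: b => u' v'; apply: complex_ext => /=; ring. Qed.

Lemma osc_measurable s : cmeasurable_fun `[0, pi] (osc s).
Proof. exact: AC_measurable (AC_cexp _). Qed.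

Lemma osc_nat_pi n : osc n%:R pi = 1.
Proof.
have one : osc 1 pi = 1.
  rewrite /osc /cexp/= mul0r expR0 !mul1r mulr1 mulr_natl cos2pi sin2pi.
  by [].
elim: n => [|n ih]; first by rewrite osc0.
by rewrite -natr1 oscD ih one mulr1.
Qed.

Lemma osc_orthogonal (m n : nat) : m != n -> cintegral `[0, pi] (osc (m%:R - n%:R)) = 0.
Proof.
move=> mn; set c := Complex 0 (2 * (m%:R - n%:R)) : R[i].
have := AC_increment (AC_cexp c) (lexx _) (pi_ge0 R) (lexx _).
have -> : cexp c pi = 1.
  have h := osc_nat_pi n; have : osc (m%:R - n%:R) pi * osc n%:R pi = 1.
    by rewrite -oscD subrK osc_nat_pi.
  by rewrite h mulr1.
rewrite cexp0 subrr cintegralZ//; last exact: AC_cintegrable (AC_cexp c).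
move=> /esym/eqP; rewrite mulf_eq0 => /orP[/eqP c0|/eqP //].
have : Im c = 0 by rewrite c0.
rewrite /c/= => /eqP; rewrite mulf_eq0 pnatr_eq0/= subr_eq0 eqr_nat.
by rewrite (negbTE mn).
Qed.

Lemma sqr_normcB (a b : R[i]) :
  normc (a - b) ^+ 2 = normc a ^+ 2 + normc b ^+ 2 - 2 * Re (conjc b * a).
Proof.
rewrite !sqr_normc cReD cImD cReN cImN cReM; case: b => u v /=; ring.
Qed.

Lemma cintegrable_osc g s : cintegrable `[0, pi] g ->
  cintegrable `[0, pi] (fun x => g x * osc s x).
Proof.
move=> gi; apply: (@eq_cintegrable _ _ (fun x => osc s x * g x)) => //.
  by move=> x _; exact: mulrC.
apply: (cintegrableMl _ (osc_measurable s) (M := 1)) => // x _.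
by rewrite normc_osc.
Qed.

(* Subtracting from g its projection on one exponential lowers the integral of |g|^2
   by |coefficient|^2 / pi and leaves the other coefficients unchanged. *)
Lemma bessel (S : seq nat) t g : uniq S -> square_integrable g ->
  \sum_(n <- S) normc (fourier g (t + n%:R)) ^+ 2 <=
  pi * Rintegral mu `[0, pi] (fun x => normc (g x) ^+ 2).
Proof.
elim: S g => [|m S ih] g /=.
  move=> _ [_ _]; rewrite big_nil mulr_ge0 ?pi_ge0//.
  by apply: Rintegral_ge0 => x _; rewrite sqr_ge0.
move=> /andP[mS uS] g2; have gi := square_integrable_integrable g2.
have p0 : 0 < pi :> R by exact: pi_gt0.
rewrite big_cons; set c := fourier g (t + m%:R).
pose pc : R[i] := Complex pi 0.
have pc0 : pc != 0 by rewrite /pc eq_complex/= gt_eqF.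
(* The projection of g on e^(-2 i (t + m) x), whose squared norm on [0, pi] is pi. *)
pose w x := c / pc * osc (- (t + m%:R)) x.
have nw x : normc (w x) = normc c / pi.
  by rewrite /w !Normc.normcM normc_osc mulr1 Normc.normcV /pc normc_real gtr0_norm.
have mw : cmeasurable_fun `[0, pi] w.
  by apply: cmeasurableM; [exact: cmeasurable_cst|exact: osc_measurable].
have w2 : square_integrable w.
  split => //; apply: eq_integrable (integrable_cst_itv 0 pi ((normc c / pi) ^+ 2)) => //.
  by move=> x _; rewrite /comp nw.
have wi := square_integrable_integrable w2.
have g'2 : square_integrable (fun x => g x - w x).
  apply: square_integrableD => //.
  by apply: (square_integrable_le (C := 1) _ _ w2);
    [exact: cmeasurableN|move=> x _; rewrite normcN mul1r].
have coef n : n \in S -> fourier (fun x => g x - w x) (t + n%:R) = fourier g (t + n%:R).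
  move=> nS; have nm : n != m by apply: contraNneq mS => <-.
  rewrite /fourier (@eq_cintegral _ _ _ (fun x => g x * osc (t + n%:R) x -
    w x * osc (t + n%:R) x)); last by move=> x _; rewrite mulrBl.
  rewrite cintegralB//; [|exact: cintegrable_osc..].
  rewrite [X in _ - X](_ : _ = 0) ?subr0//.
  rewrite [LHS](_ : _ = cintegral `[0, pi] (fun x => c / pc * osc (n%:R - m%:R) x)).
    rewrite cintegralZ//; last exact: AC_cintegrable (AC_cexp _).
    by rewrite osc_orthogonal// mulr0.
  apply: eq_cintegral => x _; rewrite /w -mulrA -oscD; congr (_ * osc _ _); ring.
have nrm : pi * Rintegral mu `[0, pi] (fun x => normc (g x - w x) ^+ 2) =
    pi * Rintegral mu `[0, pi] (fun x => normc (g x) ^+ 2) - normc c ^+ 2.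
  have ri : mu.-integrable `[0, pi] (EFin \o (fun x => Re (conjc (c / pc) * (g x * osc (t + m%:R) x)))).
    by have [] := cintegrableZ (conjc (c / pc)) (measurable_itv `[0, pi]) (cintegrable_osc (t + m%:R) gi).
  have -> : Rintegral mu `[0, pi] (fun x => normc (g x - w x) ^+ 2) =
     Rintegral mu `[0, pi] (fun x => (normc (g x) ^+ 2 + (normc c / pi) ^+ 2) +
        (-2) * Re (conjc (c / pc) * (g x * osc (t + m%:R) x))).
    apply: eq_Rintegral => x _; rewrite sqr_normcB nw mulNr; congr (_ - 2 * Re _).
    rewrite /w; have -> : conjc (c / pc * osc (- (t + m%:R)) x) =
        conjc (c / pc) * osc (t + m%:R) x.
      by rewrite -(conjc_osc (t + m%:R)); exact: conjcM.
    by ring.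
  rewrite RintegralD//; last 2 first.
  - by apply: integrable_EFinD => //; [exact: g2.2|exact: integrable_cst_itv].
  - exact: integrable_EFinZ.
  rewrite RintegralD//; [|exact: g2.2|exact: integrable_cst_itv].
  rewrite Rintegral_cst_pi RintegralZl//.
  have -> : Rintegral mu `[0, pi] (fun x => Re (conjc (c / pc) * (g x * osc (t + m%:R) x))) =
      Re (cintegral `[0, pi] (fun x => conjc (c / pc) * (g x * osc (t + m%:R) x))) by [].
  rewrite cintegralZ//; last exact: cintegrable_osc.
  rewrite -/(fourier g (t + m%:R)) -/c.
  have -> : Re (conjc (c / pc) * c) = normc c ^+ 2 / pi.
    have -> : c / pc = c * Complex (pi^-1) 0.
      congr (_ * _); apply: (mulfI pc0); rewrite mulfV//.
      by apply: complex_ext; rewrite ?cReM ?cImM/= ?mulfV ?gt_eqF//; ring.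
    by rewrite sqr_normc; case: (c) => u v /=; ring.
  have pn0 : pi != 0 :> R by rewrite gt_eqF.
  have alg (I n P : R) : P != 0 ->
      P * (I + (n / P) ^+ 2 * P + -2 * (n ^+ 2 / P)) = P * I - n ^+ 2.
    by move=> P0; field.
  exact: alg.
have := ih _ uS g'2; rewrite nrm.
rewrite [X in X <= _](_ : _ = \sum_(n <- S) normc (fourier g (t + n%:R)) ^+ 2); last first.
  by apply: eq_big_seq => n nS; rewrite coef.
by rewrite lerBrDr addrC.
Qed.

End Bessel.

(** * Square integrability of the Fourier integral over the real line *)

Section Plancherel.
Context {R : realType}.
Notation mu := (@lebesgue_measure R).
Implicit Types (g : R -> R[i]) (h : R -> R) (s t x : R).

Lemma lipschitz_continuous h (K : R) :
  (forall s t, `|h s - h t| <= K * `|s - t|) -> continuous h.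
Proof.
move=> hK s; apply/cvgrPdist_le => e e0.
have K0 : 0 < `|K| + 1 by have := normr_ge0 K; lra.
apply/nbhs_ballP; exists (e / (`|K| + 1)); first by rewrite /= divr_gt0.
move=> t; rewrite /ball/= ltr_pdivlMr// => st.
apply: (le_trans (hK s t)); apply: le_trans (ltW st).
rewrite [leRHS]mulrC ler_wpM2r//; have := ler_norm K; lra.
Qed.

Lemma osc_sub1_le (d x : R) : 0 <= x <= pi -> normc (osc d x - 1) <= 2 * pi * `|d|.
Proof.
move=> /andP[x0 xpi]; set c : R[i] := Complex 0 (2 * d).
have nc : normc c = 2 * `|d|.
  by rewrite /c/= expr0n/= add0r sqrtr_sqr normrM ger0_norm.
have := AC_increment_le (AC_cexp c) (lexx _) x0 xpi; rewrite cexp0 -/(osc d x).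
move=> /le_trans; apply.
rewrite (@eq_Rintegral _ _ _ _ _ (fun=> 2 * `|d|)); last first.
  by move=> t _; rewrite Normc.normcM nc -/(osc d t) normc_osc mulr1.
rewrite Rintegral_cst//= lebesgue_measure_itv/= lte_fin.
have -> : 2 * pi * `|d| = 2 * `|d| * pi by ring.
rewrite ler_wpM2l ?mulr_ge0//; case: ifP => _ //=; last exact: pi_ge0.
by rewrite subr0.
Qed.

(** It provides the continuity in s on which measurability over the line and the change of variable
    on unit intervals rest. *)
Lemma fourier_lipschitz g s t : cintegrable `[0, pi] g ->
  normc (fourier g s - fourier g t) <=
  2 * pi * Rintegral mu `[0, pi] (fun x => normc (g x)) * `|s - t|.
Proof.
move=> gi; have ni := cintegrable_normc (measurable_itv `[0, pi]) gi.
rewrite /fourier -cintegralB//; [|exact: cintegrable_osc..].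
have -> : 2 * pi * Rintegral mu `[0, pi] (fun x => normc (g x)) * `|s - t| =
    Rintegral mu `[0, pi] (fun x => 2 * pi * `|s - t| * normc (g x)).
  by rewrite RintegralZl//; ring.
apply: le_normc_cintegral_bound => //.
- apply: cintegrable_measurable; apply: cintegrableB => //; exact: cintegrable_osc.
- exact: integrable_EFinZ.
- move=> x /=; rewrite in_itv/= => xpi.
  have -> : g x * osc s x - g x * osc t x = (osc (s - t) x - 1) * osc t x * g x.
    have -> : osc s x = osc (s - t) x * osc t x by rewrite -oscD subrK.
    by ring.
  by rewrite !Normc.normcM normc_osc mulr1 ler_wpM2r ?normc_ge0 ?osc_sub1_le.
Qed.

Lemma continuous_sqr_fourier g : cintegrable `[0, pi] g ->
  continuous (fun s => normc (fourier g s) ^+ 2).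
Proof.
move=> gi s; apply: (@continuousM _ _ (fun s => normc (fourier g s)) (fun s => normc (fourier g s)));
  apply: lipschitz_continuous => {}s t; apply: le_trans (fourier_lipschitz s t gi);
  rewrite ler_norml; have := ler_normc_dist (fourier g s) (fourier g t);
  have := ler_normc_dist (fourier g t) (fourier g s); rewrite (normc_distC (fourier g t)); lra.
Qed.

Lemma continuous_integrable_itv h (a b : R) : continuous h ->
  mu.-integrable `[a, b] (EFin \o h).
Proof.
move=> ch; apply: continuous_compact_integrable; first exact: segment_compact.
exact: continuous_subspaceT.
Qed.

Lemma Rintegral_shift h (a : R) : continuous h ->
  Rintegral mu `[a, a + 1] h = Rintegral mu `[0, 1] (fun x => h (x + a)).
Proof.
move=> ch; pose F x := x + a.
have dF x : is_derive x 1 F 1.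
  have -> : F = id + cst a by [].
  by apply: is_derive_eq; rewrite addr0.
have F' : derive1 F = cst 1.
  by apply/funext => x; rewrite derive1E; have [_ ->] := dF x.
have cF : continuous F.
  by move=> x; apply: differentiable_continuous; apply/derivable1_diffP; have [] := dF x.
have := @integration_by_substitution_increasing R F h 0 1 ler01.
rewrite /F add0r (addrC 1 a) -/F F' /Rintegral => -> //.
- by congr fine; apply: eq_integral => x _; rewrite /= mulr1.
- by move=> x y _ _ xy; rewrite ltrD2r.
- by move=> x _; exact: cst_continuous.
- by apply: is_cvg_cst.
- by apply: is_cvg_cst.
- split.
  + by move=> x _; have [] := dF x.
  + by apply: cvg_at_right_filter; have := cF 0; rewrite /continuous_at /F.
  + by apply: cvg_at_left_filter; have := cF 1; rewrite /continuous_at /F.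
- exact: continuous_subspaceT.
Qed.

Lemma continuous_shift h (a : R) : continuous h -> continuous (fun x => h (x + a)).
Proof.
move=> ch x; apply: continuous_comp; last exact: ch.
by apply: cvgD; [exact: cvg_id|exact: cvg_cst].
Qed.

Lemma continuous_shift_sum h (a : R) n : continuous h ->
  continuous (fun x => \sum_(0 <= i < n) h (x + (a + i%:R))).
Proof.
move=> ch; elim: n => [|n ih] x.
  by under eq_fun do rewrite big_nil; exact: cst_continuous.
under eq_fun do rewrite big_nat_recr//=.
by apply: cvgD; [exact: ih|exact: continuous_shift].
Qed.

Lemma Rintegral_unit_periods h (a : R) n : continuous h ->
  Rintegral mu `[a, a + n%:R] h =
  Rintegral mu `[0, 1] (fun x => \sum_(0 <= i < n) h (x + (a + i%:R))).
Proof.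
move=> ch; elim: n => [|n ih].
  rewrite addr0 set_itv1 Rintegral_set1.
  by under eq_Rintegral do rewrite big_nil; rewrite Rintegral_cst// mul0r.
rewrite (@Rintegral_itv_split _ a (a + n%:R) (a + n.+1%:R)); last 3 first.
- by rewrite lerDl.
- by rewrite lerD2l ler_nat.
- exact: continuous_integrable_itv.
rewrite ih -natr1 addrA Rintegral_shift// -RintegralD//; last 2 first.
- by apply: continuous_integrable_itv; exact: continuous_shift_sum.
- by apply: continuous_integrable_itv; exact: continuous_shift.
by apply: eq_Rintegral => x _; rewrite big_nat_recr.
Qed.

(** Folding the line onto [0, 1] turns the integral of |fourier g|^2 into the integral over x of the
    sum of |fourier g (x + n)|^2. For each x Bessel's inequality bounds that sum by the same
    constant. *)
Lemma fourier_le g : square_integrable g ->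
  (\int[mu]_x (normc (fourier g x) ^+ 2)%:E <=
   (pi * Rintegral mu `[0, pi] (fun x => normc (g x) ^+ 2))%:E)%E.
Proof.
move=> g2; have gi := square_integrable_integrable g2.
have ch := continuous_sqr_fourier gi.
set h := fun x => normc (fourier g x) ^+ 2; set B := pi * _.
have hle n : Rintegral mu `[- n%:R, n%:R] h <= B.
  (* The interval [-n, n] is read as 2 n unit periods starting at -n, so the Bessel shift at x is x
     - n. *)
  have -> : n%:R = - n%:R + (n + n)%:R :> R by rewrite natrD; ring.
  rewrite -{1}(_ : - n%:R = - (- n%:R + (n + n)%:R) :> R); last by rewrite natrD; ring.
  rewrite Rintegral_unit_periods//.
  apply: (@le_trans _ _ (Rintegral mu `[0, 1] (fun=> B))); last first.
    by rewrite Rintegral_cst//= lebesgue_measure_itv/= lte_fin ltr01 -EFinD/= subr0 mulr1.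
  apply: le_Rintegral => //.
  - by apply: continuous_integrable_itv; exact: continuous_shift_sum.
  - by apply: continuous_integrable_itv; exact: cst_continuous.
  - move=> x _; have := @bessel _ (index_iota 0 (n + n)) (x - n%:R) g (iota_uniq _ _) g2.
    by under eq_bigr do rewrite -addrA.
have mh : measurable_fun setT h by exact: continuous_measurable_fun.
pose F n : set (measurableTypeR R) := `[- n%:R, n%:R]%classic.
have FT : \bigcup_n F n = setT.
  apply/seteqP; split => // x _; exists (Num.bound `|x|) => //=.
  have := archi_boundP (normr_ge0 x); rewrite /F/= in_itv/= ltr_norml; lra.
(* Monotone convergence along the intervals [-n, n], which exhaust the line. *)
have cv : (\int[mu]_(x in F n) (h x)%:E)%E @[n --> \oo] --> (\int[mu]_x (h x)%:E)%E.
  rewrite -FT; apply: ge0_nondecreasing_set_cvg_integral.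
  - move=> m n mn; rewrite subsetEset /F => x /=; rewrite !in_itv/= => /andP[? ?].
    have : (m%:R <= n%:R :> R) by rewrite ler_nat.
    lra.
  - by move=> n; exact: measurable_itv.
  - by move=> n; apply/measurable_EFinP; apply: measurable_funS mh.
  - by move=> n x _; rewrite lee_fin sqr_ge0.
rewrite -(cvg_lim _ cv)//; apply: lime_le; first by apply/cvg_ex; eexists; exact: cv.
apply: nearW => n.
have fi := continuous_integrable_itv (- n%:R) n%:R ch.
rewrite -[leLHS]fineK ?lee_fin; first exact: hle.
exact: integrable_fin_num fi.
Qed.

End Plancherel.

(** * The Wronskian identity and comparison with the free solution *)

Section WeylDifference.
Context {R : realType} {N : nat}.
Notation mu := (@lebesgue_measure R).
Notation AC := abs_continuous_with.
Implicit Types (c : R[i]) (q qt y dy z dz : 'I_N -> R -> R[i]) (j k : 'I_N).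

Lemma edge_wronskian c (q qt y dy z dz : R -> R[i]) :
  edge_solution c (fun x => q x * y x) y dy ->
  edge_solution c (fun x => qt x * z x) z dz ->
  (y pi * dz pi - dy pi * z pi) - (y 0 * dz 0 - dy 0 * z 0) =
  cintegral `[0, pi] (fun x => (qt x - q x) * (y x * z x)).
Proof.
move=> [acy acdy] [acz acdz].
have acW := AC_B (AC_M acy acdz) (AC_M acdy acz).
rewrite (AC_increment acW (lexx _) (pi_ge0 R) (lexx _)).
by apply: eq_cintegral => x _; ring.
Qed.

(** At the vertex the Wronskians sum to a common value times a zero flux sum, twice. At the outer
    ends all values vanish except on edge k, where both are 1 and the difference of the derivatives
    remains. *)
Lemma star_wronskian c k q qt y dy z dz : (0 < N)%N -> val k != 0%N ->
  star_solution c 1 k (fun j x => q j x * y j x) y dy ->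
  star_solution c 1 k (fun j x => qt j x * z j x) z dz ->
  dy k 0 - dz k 0 =
  \sum_j cintegral `[0, pi] (fun x => (qt j x - q j x) * (y j x * z j x)).
Proof.
move=> N0 k0 sy sz; have [ey my _ _] := sy; have [ez mz _ _] := sz.
have [[Y hY] fy] := (star_matchingP y dy N0).1 my.
have [[Z hZ] fz] := (star_matchingP z dz N0).1 mz.
transitivity (\sum_j ((vertex_value y j * vertex_flux dz j - vertex_flux dy j * vertex_value z j) -
   (end_value y j * end_flux dz j - end_flux dy j * end_value z j))); last first.
  apply: eq_bigr => j _; rewrite -(edge_wronskian (ey j) (ez j)).
  by rewrite /vertex_value /end_value /vertex_flux /end_flux; case: ifP => _; ring.
rewrite sumrB sumrB.
under eq_bigr do rewrite hY.
under [X in _ - X - _]eq_bigr do rewrite hZ.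
rewrite -mulr_sumr -mulr_suml fy fz mulr0 mul0r subrr sub0r (bigD1 k)//= big1; last first.
  move=> j jk; rewrite (star_solution_end_value _ k0 sy) (star_solution_end_value _ k0 sz).
  by rewrite (negbTE jk) !mulr0 mul0r subrr.
rewrite (star_solution_end_value _ k0 sy) (star_solution_end_value _ k0 sz) eqxx.
by rewrite /end_flux (negbTE k0) /= mulr1n; ring.
Qed.

(** For zero forcing the errors in [edge_incoming] and [edge_outgoing] vanish, so the waves are
    exact exponentials. The amplitudes are at most 5 |c|, and division by 2 c gives 5/2. *)
Lemma star_free_expansion c k y dy j : (0 < N)%N -> val k != 0%N ->
  c != 0 -> Re c <= 0 -> normc (cexp c pi) <= 1 / 2 ->
  star_solution c 1 k (fun _ _ => 0) y dy ->
  exists al be : R[i], [/\ normc al <= 5 / 2, normc be <= 5 / 2 &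
    forall x, 0 <= x <= pi -> y j x = al * cexp c x + be * cexp c (pi - x)].
Proof.
move=> N0 k0 c0 Rec E2 ss; have [es _ _ _] := ss.
have cgt : 0 < normc c.
  rewrite lt_neqAle normc_ge0 andbT; apply: contra_neq c0 => /esym.
  exact: Normc.eq0_normc.
have two0 : (2 : R[i]) != 0 by rewrite pnatr_eq0.
have half (a : R[i]) : normc a <= 5 * normc c -> normc ((2 * c)^-1 * a) <= 5 / 2.
  move=> ac; rewrite Normc.normcM Normc.normcV Normc.normcM normc_nat.
  by rewrite mulrC ler_pdivrMr ?mulr_gt0//; lra.
have z0 : Rintegral mu `[0, pi] (fun t => normc (0 : R[i])) = 0.
  by rewrite Rintegral_cst// Normc.normc0 mul0r.
have a1 : normc (1 : R[i]) <= 1 by rewrite Normc.normc1.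
have z0' (i : 'I_N) : Rintegral mu `[0, pi] (fun t => normc (0 : R[i])) <= 0.
  by rewrite z0.
have [b1 b2] := star_amplitudes N0 k0 Rec E2 ss a1 z0' j.
rewrite mulr1 mulr0 addr0 in b1 b2.
exists ((2 * c)^-1 * (dy j 0 + c * y j 0)), ((2 * c)^-1 * - (dy j pi - c * y j pi)).
split; [exact: half|by apply: half; rewrite normcN|].
move=> x xpi.
have h1 := edge_incoming (es j) Rec xpi; have h2 := edge_outgoing (es j) Rec xpi.
rewrite z0 in h1 h2.
have eq0 (a b : R[i]) : normc (a - b) <= 0 -> a = b.
  move=> ab; apply/eqP; rewrite -subr_eq0; apply/eqP/Normc.eq0_normc/eqP.
  by rewrite eq_le ab normc_ge0.
transitivity ((2 * c)^-1 * ((dy j x + c * y j x) - (dy j x - c * y j x))).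
  by field; rewrite c0.
by rewrite (eq0 _ _ h1) (eq0 _ _ h2); ring.
Qed.

(* The product of two solutions differs by O(delta) from the square of the free
   solution, whose constant part is annihilated by the mean-zero factor p. *)
Lemma edge_integral_le c (p y z y0 : R -> R[i]) (al be : R[i]) (d : R) :
  Re c <= 0 -> cintegrable `[0, pi] p -> cintegral `[0, pi] p = 0 ->
  cmeasurable_fun `[0, pi] y -> cmeasurable_fun `[0, pi] z ->
  normc al <= 5 / 2 -> normc be <= 5 / 2 ->
  (forall x, 0 <= x <= pi -> y0 x = al * cexp c x + be * cexp c (pi - x)) ->
  (forall x, 0 <= x <= pi -> normc (y x - y0 x) <= d) ->
  (forall x, 0 <= x <= pi -> normc (z x - y0 x) <= d) ->
  (forall x, 0 <= x <= pi -> normc (z x) <= 10) ->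
  normc (cintegral `[0, pi] (fun x => p x * (y x * z x))) <=
  25 / 4 * (normc (cintegral `[0, pi] (fun x => p x * cexp (c + c) x)) +
            normc (cintegral `[0, pi] (fun x => p x * cexp (c + c) (pi - x)))) +
  15 * d * Rintegral mu `[0, pi] (fun x => normc (p x)).
Proof.
move=> Rec pint p0 my mz alb beb y0E yd zd zb.
have mE1 := AC_measurable (AC_cexp (c + c)).
have e2E x : cexp (c + c) (pi - x) = cexp (c + c) pi * cexp (- (c + c)) x.
  by rewrite cexpD cexpNl.
have mE2 : cmeasurable_fun `[0, pi] (fun x => cexp (c + c) (pi - x)).
  rewrite (_ : (fun x => _) = fun x => cexp (c + c) pi * cexp (- (c + c)) x); last first.
    by apply/funext => x; exact: e2E.
  apply: cmeasurableM; first exact: cmeasurable_cst.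
  exact: AC_measurable (AC_cexp _).
have Rec2 : Re (c + c) <= 0 by rewrite cReD; lra.
have bI (w : R -> R[i]) (M : R) : cmeasurable_fun `[0, pi] w ->
    (forall x, 0 <= x <= pi -> normc (w x) <= M) -> cintegrable `[0, pi] (fun x => p x * w x).
  move=> mw wM; apply: (@eq_cintegrable _ _ (fun x => w x * p x)) => //.
    by move=> x _; exact: mulrC.
  by apply: (cintegrableMl _ mw) => // x /=; rewrite in_itv/=; exact: wM.
have i1 : cintegrable `[0, pi] (fun x => p x * cexp (c + c) x).
  by apply: (bI _ 1) => // x xpi; apply: normc_cexp_le1 => //; lra.
have i2 : cintegrable `[0, pi] (fun x => p x * cexp (c + c) (pi - x)).
  by apply: (bI _ 1) => // x xpi; apply: normc_cexp_le1 => //; lra.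
have y0b x : 0 <= x <= pi -> normc (y0 x) <= 5.
  move=> xpi; rewrite y0E// (le_trans (ler_normcD _ _))// !Normc.normcM.
  have h1 : normc (cexp c x) <= 1 by apply: normc_cexp_le1 => //; lra.
  have h2 : normc (cexp c (pi - x)) <= 1 by apply: normc_cexp_le1 => //; lra.
  have := normc_ge0 al; have := normc_ge0 be.
  have := normc_ge0 (cexp c x); have := normc_ge0 (cexp c (pi - x)); nra.
(* The square of the free solution: in the cross term e^(c x) e^(c (pi - x)) = e^(c pi) is constant
   in x, hence orthogonal to p. *)
pose sq x := al ^+ 2 * cexp (c + c) x + be ^+ 2 * cexp (c + c) (pi - x) + 2 * al * be * cexp c pi.
have sqE x : 0 <= x <= pi -> sq x = y0 x * y0 x.
  move=> xpi; rewrite y0E// /sq !cexpDl.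
  have -> : cexp c pi = cexp c x * cexp c (pi - x) by rewrite -cexpD addrC subrK.
  by ring.
have msq : cmeasurable_fun `[0, pi] sq.
  apply: cmeasurableD; last exact: cmeasurable_cst.
  by apply: cmeasurableD; apply: cmeasurableM => //; exact: cmeasurable_cst.
pose rem x := y x * z x - sq x.
have mrem : cmeasurable_fun `[0, pi] rem.
  by apply: cmeasurableD; [exact: cmeasurableM|exact: cmeasurableN].
(* Here 15 = 10 + 5, the bounds on z and on the free solution. *)
have remb x : 0 <= x <= pi -> normc (rem x) <= 15 * d.
  move=> xpi; rewrite /rem sqE//.
  have -> : y x * z x - y0 x * y0 x = (y x - y0 x) * z x + y0 x * (z x - y0 x) by ring.
  rewrite (le_trans (ler_normcD _ _))// !Normc.normcM.
  have := yd x xpi; have := zd x xpi; have := zb x xpi; have := y0b x xpi.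
  have := normc_ge0 (y x - y0 x); have := normc_ge0 (z x - y0 x).
  have := normc_ge0 (z x); have := normc_ge0 (y0 x); nra.
have irem := bI rem _ mrem remb.
have -> : cintegral `[0, pi] (fun x => p x * (y x * z x)) =
    al ^+ 2 * cintegral `[0, pi] (fun x => p x * cexp (c + c) x) +
    be ^+ 2 * cintegral `[0, pi] (fun x => p x * cexp (c + c) (pi - x)) +
    2 * al * be * cexp c pi * cintegral `[0, pi] p +
    cintegral `[0, pi] (fun x => p x * rem x).
  rewrite -!cintegralZ// -!cintegralD//; try exact: cintegrableZ; last first.
  - by apply: cintegrableD => //; exact: cintegrableZ.
  - apply: cintegrableD => //; last exact: cintegrableZ.
    by apply: cintegrableD => //; exact: cintegrableZ.
  by apply: eq_cintegral => x _; rewrite /rem /sq; ring.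
rewrite p0 mulr0 addr0.
apply: (le_trans (ler_normcD _ _)); apply: lerD.
  apply: (le_trans (ler_normcD _ _)); rewrite !Normc.normcM mulrDr.
  have := normc_ge0 al; have := normc_ge0 be => n1 n2.
  by apply: lerD; apply: ler_wpM2r; rewrite ?normc_ge0//; nra.
have np := cintegrable_normc (measurable_itv `[0, pi]) pint.
rewrite -RintegralZl//; apply: le_normc_cintegral_bound => //.
- exact: cintegrable_measurable.
- exact: integrable_EFinZ.
- move=> x /=; rewrite in_itv/= => xpi.
  by rewrite Normc.normcM mulrC ler_wpM2r ?normc_ge0 ?remb.
Qed.

End WeylDifference.

(** * The height of the line of integration *)

Section LineHeight.
Context {R : realType}.

(** The base is 8 + 1/4, so the denominator in [line_height] is at most 1/4 for every N. *)
Lemma bernoulli_8_3 N : (2 <= N)%N -> 8 ^+ N + 3 ^+ N.-1 <= (33 / 4) ^+ N :> R.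
Proof.
case: N => [|[|N]]// _; elim: N => [|N ih]; first by rewrite !expr2 expr1; lra.
have -> : 8 ^+ N.+3 = 8 * 8 ^+ N.+2 :> R by rewrite exprS.
have -> : 3 ^+ N.+3.-1 = 3 * 3 ^+ N.+1 :> R by rewrite /= [LHS]exprS.
have -> : (33 / 4) ^+ N.+3 = 33 / 4 * (33 / 4) ^+ N.+2 :> R by rewrite exprS.
have h8 : 0 <= 8 ^+ N.+2 :> R by rewrite exprn_ge0.
have h3 : 0 <= 3 ^+ N.+1 :> R by rewrite exprn_ge0.
move: ih h8 h3; rewrite /=.
move: (8 ^+ N.+2 : R) (3 ^+ N.+1 : R) ((33 / 4) ^+ N.+2 : R) => u v w; lra.
Qed.

(** The two lower bounds in the maximum give the two estimates: e^(-2 pi b) <= 1/4 from the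
    logarithm, and the lower bound on b from the quotient, whose denominator lies in (0, 1/4]. *)
Lemma line_height_spec N (r : R) : (2 <= N)%N -> 0 < r ->
  [/\ 0 < line_height N r, expR (- line_height N r * pi) <= 1 / 2 &
      17 * (Num.sqrt pi * r) <= line_height N r].
Proof.
move=> N2 r0; have p0 : 0 < pi :> R by exact: pi_gt0.
set b := line_height N r.
have ln4 : 0 < ln 4 :> R by rewrite ln_gt0// ltr1n.
have b1 : ln 4 / (2 * pi) <= b by rewrite /b /line_height le_max lexx.
have b0 : 0 < b by apply: lt_le_trans b1; rewrite divr_gt0// mulr_gt0.
split => //.
- have h : expR (- b * pi) ^+ 2 <= 1 / 4.
    rewrite -expRM_natl; have -> : (1 / 4 : R) = expR (- ln 4).
      by rewrite expRN lnK ?posrE// div1r.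
    rewrite ler_expR mulNr mulrN lerN2 mulrCA -ler_pdivrMr ?mulr_gt0//.
  by have := expR_gt0 (- b * pi); nra.
- have N0 : (N%:R : R) != 0 by rewrite pnatr_eq0 -lt0n ltnW.
  set X := 8 ^+ N + 3 ^+ N.-1 : R.
  have root (a : R) : 0 <= a -> (a ^+ N) `^ N%:R^-1 = a.
    by move=> a0; rewrite -powR_mulrn// -powRrM mulfV// powRr1.
  have X0 : 0 < X by rewrite addr_gt0 ?exprn_gt0.
  have Ninv : 0 < N%:R^-1 :> R by rewrite invr_gt0 ltr0n ltnW.
  have e0 : 0 < X `^ N%:R^-1 - 8.
    rewrite subr_gt0 -{1}(root 8)//; apply: gt0_ltr_powR => //.
    - by rewrite nnegrE exprn_ge0.
    - by rewrite nnegrE ltW.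
    - by rewrite /X ltrDl exprn_gt0.
  have e1 : X `^ N%:R^-1 - 8 <= 1 / 4.
    rewrite lerBlDr (_ : 1 / 4 + 8 = 33 / 4 :> R); last by lra.
    rewrite -(root (33 / 4)); last by lra.
    apply: ge0_ler_powR; rewrite ?nnegrE ?(ltW X0) ?(ltW Ninv)//.
    exact: bernoulli_8_3.
  apply: (@le_trans _ _ (4 * r * (Num.sqrt pi + Num.sqrt (2 * pi)
              + 24 * pi ^+ 2 * r * expR (2 * pi `^ (3 / 2) * r)) / (X `^ N%:R^-1 - 8))); last first.
    by rewrite /b /line_height le_max lexx orbT.
  rewrite ler_pdivlMr//.
  set S := Num.sqrt pi; set S2 := Num.sqrt (2 * pi); set T := 24 * _ * _ * _.
  have S0 : 0 <= S by exact: sqrtr_ge0.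
  have SS : S <= S2 by apply: ler_wsqrtr; lra.
  have T0 : 0 <= T by rewrite !mulr_ge0 ?expR_ge0 ?sqr_ge0// ltW.
  have h1 : 17 * (S * r) * (X `^ N%:R^-1 - 8) <= 17 * (S * r) * (1 / 4).
    by rewrite ler_wpM2l// !mulr_ge0// ltW.
  apply: (le_trans h1).
  (* The numerator is thus at least 8 S r, which exceeds the required 17/4 S r. *)
  have h2 : r * (2 * S) <= r * (S + S2 + T) by rewrite ler_wpM2l ?(ltW r0)//; lra.
  have h3 : 0 <= S * r by rewrite mulr_ge0// ltW.
  lra.
Qed.

End LineHeight.

(** * Integral bounds for nonnegative majorants on the line *)

Section IntegralBound.
Context {R : realType}.
Notation mu := (@lebesgue_measure R).
Implicit Types (f g : R -> R).

(* The majorised function need not be measurable: the integral of a nonnegative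
   function is a supremum over the simple functions below it. *)
Lemma ge0_le_integralT (f g : R -> \bar R) : (forall x, (0 <= f x)%E) ->
  (forall x, (f x <= g x)%E) -> (\int[mu]_x f x <= \int[mu]_x g x)%E.
Proof.
move=> f0 fg; have g0 x : (0 <= g x)%E by exact: le_trans (f0 x) (fg x).
rewrite !ge0_integralTE//; apply: le_ereal_sup => _ [h /= hf <-]; exists h => //= x.
exact: le_trans (hf x) (fg x).
Qed.

(** Measurability and positivity are bundled with the bound because additivity of the integral needs
    them; the majorant is assembled from such pieces. *)
Definition integral_le f (C : R) :=
  [/\ measurable_fun (setT : set (measurableTypeR R)) f, forall x, 0 <= f x &
      (\int[mu]_x (f x)%:E <= C%:E)%E].

Lemma integral_leD f g C D : integral_le f C -> integral_le g D ->
  integral_le (fun x => f x + g x) (C + D).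
Proof.
move=> [mf f0 fC] [mg g0 gD]; split.
- exact: measurable_funD.
- by move=> x; rewrite addr_ge0.
- under eq_integral do rewrite EFinD.
  rewrite ge0_integralD//; first by rewrite EFinD leeD.
  + by move=> x _; rewrite lee_fin.
  + exact/measurable_EFinP.
  + by move=> x _; rewrite lee_fin.
  + exact/measurable_EFinP.
Qed.

Lemma integral_leZ f C k : 0 <= k -> integral_le f C ->
  integral_le (fun x => k * f x) (k * C).
Proof.
move=> k0 [mf f0 fC]; split.
- exact: measurable_funM.
- by move=> x; rewrite mulr_ge0.
- under eq_integral do rewrite EFinM.
  rewrite ge0_integralZl_EFin//; first by rewrite EFinM lee_wpmul2l.
  + by move=> x _; rewrite lee_fin.
  + exact/measurable_EFinP.
Qed.

Lemma integral_le_sum (I : Type) (s : seq I) (f : I -> R -> R) (C : I -> R) :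
  (forall i, integral_le (f i) (C i)) ->
  integral_le (fun x => \sum_(i <- s) f i x) (\sum_(i <- s) C i).
Proof.
move=> fC; elim: s => [|i s ih].
  rewrite big_nil (_ : (fun x => _) = cst 0); last first.
    by apply/funext => x; rewrite big_nil.
  by split => //; rewrite integral0.
rewrite big_cons (_ : (fun x => _) = fun x => f i x + \sum_(i <- s) f i x); last first.
  by apply/funext => x; rewrite big_cons.
exact: integral_leD.
Qed.

Lemma integral_le_oneDsqrV : integral_le (fun x => (oneDsqr x)^-1) pi.
Proof.
split.
- exact: continuous_measurable_fun continuous_oneDsqrV.
- by move=> x; rewrite invr_ge0 (le_trans ler01)// oneDsqr_ge1.
- have f0 (x : R) : 0 <= (oneDsqr x)^-1.
    by rewrite invr_ge0 (le_trans ler01)// oneDsqr_ge1.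
  have ev : (fun x : R => (oneDsqr x)^-1) =1 (fun x => (oneDsqr x)^-1) \o -%R.
    by move=> x; rewrite /= /oneDsqr sqrrN.
  rewrite (ge0_symfun_integralT f0 continuous_oneDsqrV ev).
  rewrite -set_itvcy integral0y_oneDsqr -EFinM lee_fin; lra.
Qed.

(** Iterating (x + y)^2 <= 2 x^2 + 2 y^2 costs a factor 2 per term, which is harmless as N is
    fixed. *)
Lemma sqr_sum_le (I : Type) (s : seq I) (a : I -> R) :
  (\sum_(i <- s) a i) ^+ 2 <= 2 ^+ size s * \sum_(i <- s) a i ^+ 2.
Proof.
elim: s => [|i s ih]; first by rewrite !big_nil expr0n mulr0.
rewrite !big_cons /= [2 ^+ _.+1]exprS.
have S0 : 0 <= \sum_(j <- s) a j ^+ 2 by apply: sumr_ge0 => j _; exact: sqr_ge0.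
have P1 : 1 <= 2 ^+ size s :> R by rewrite exprn_ege1// ler1n.
have := sqr_ge0 (a i - \sum_(j <- s) a j); have := sqr_ge0 (a i).
move: ih P1 S0; move: (2 ^+ _) (\sum_(j <- s) a j) (\sum_(j <- s) a j ^+ 2) => P A B.
move=> h1 h2 h3 h4 h5; nra.
Qed.

End IntegralBound.

(** * The Fourier integral at reflected frequencies *)

Section FourierReflected.
Context {R : realType}.
Notation mu := (@lebesgue_measure R).
Implicit Types (g : R -> R[i]).

Lemma normc_conjc (z : R[i]) : normc (conjc z) = normc z.
Proof. by case: z => a b /=; rewrite sqrrN. Qed.

(** Conjugating g replaces the substitution s -> -s in the integral over the line. *)
Lemma fourier_opp g s : cintegrable `[0, pi] g ->
  fourier g (- s) = conjc (fourier (fun x => conjc (g x)) s).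
Proof.
move=> gi; have ci := cintegrable_osc (- s) gi.
rewrite /fourier (@eq_cintegral _ _ (fun x => conjc (g x) * osc s x)
  (fun x => conjc (g x * osc (- s) x))); last first.
  by move=> x _; rewrite conjcM conjc_osc.
apply: complex_ext.
- by rewrite /=; apply: eq_Rintegral => x _; case: (g x * _).
- have := cintegralN (measurable_itv `[0, pi]) ci.
  move=> /(congr1 (@complex.Im R)); rewrite cImN => h.
  transitivity (- Im (cintegral `[0, pi] (fun x => - (g x * osc (- s) x)))).
    by rewrite h opprK.
  by rewrite /=; congr (- _); apply: eq_Rintegral => x _; case: (g x * _).
Qed.

Lemma fourier_opp_le g : square_integrable g ->
  (\int[mu]_x (normc (fourier g (- x)) ^+ 2)%:E <=
   (pi * Rintegral mu `[0, pi] (fun x => normc (g x) ^+ 2))%:E)%E.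
Proof.
move=> g2; have gi := square_integrable_integrable g2.
under eq_integral do rewrite fourier_opp// normc_conjc.
have [[g1 g1'] g3] := g2.
have -> : Rintegral mu `[0, pi] (fun x => normc (g x) ^+ 2) =
    Rintegral mu `[0, pi] (fun x => normc (conjc (g x)) ^+ 2).
  by apply: eq_Rintegral => x _; rewrite normc_conjc.
apply: fourier_le.
apply: (square_integrable_le (C := 1) _ _ g2); last by move=> x _; rewrite normc_conjc mul1r.
split.
- by rewrite (_ : (fun x => _) = fun x => Re (g x))//; apply/funext => x; case: (g x).
- rewrite (_ : (fun x => _) = fun x => - Im (g x)); first exact: measurableT_comp.
  by apply/funext => x; case: (g x).
Qed.

End FourierReflected.

(** * Pointwise estimate of the difference of Weyl functions *)

Section WeylFunction.
Context {R : realType} {N : nat}.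
Notation mu := (@lebesgue_measure R).
Notation AC := abs_continuous_with.
Implicit Types (q qt : 'I_N -> R -> R[i]) (j k : 'I_N).

Lemma inL2_spec (q : R -> R[i]) : inL2 `]0, pi[ q -> square_integrable q /\
  L2norm `]0, pi[ q = (Num.sqrt (Rintegral mu `[0, pi] (fun x => normc (q x) ^+ 2)))%:E.
Proof.
move=> [mq qoo].
have mq' := cmeasurable_oo_cc mq.
have mn2 : measurable_fun (`[0, pi]%classic : set (measurableTypeR R))
    (fun x => (normc (q x) ^+ 2)%:E).
  by apply/measurable_EFinP; apply: measurable_funX; exact: (cmeasurable_normc mq').
have IE : (\int[mu]_(x in `]0%R, pi[) (normc (q x) ^+ 2)%:E =
           \int[mu]_(x in `[0%R, pi]) (normc (q x) ^+ 2)%:E)%E.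
  rewrite integral_itv_obnd_cbnd ?integral_itv_bndo_bndc//.
  - by apply: measurable_funS mn2 => // x /=; rewrite !in_itv/= => /andP[-> /ltW ->].
  - apply: measurable_funS mn2 => // x /=; rewrite !in_itv/= => /andP[/ltW -> /ltW ->] //.
have I0 : (0 <= \int[mu]_(x in `[0%R, pi]) (normc (q x) ^+ 2)%:E)%E.
  by apply: integral_ge0 => x _; rewrite lee_fin sqr_ge0.
have Ioo : (\int[mu]_(x in `[0%R, pi]) (normc (q x) ^+ 2)%:E < +oo)%E.
  rewrite ltey; apply/eqP => Iy; move: qoo; rewrite /L2norm IE Iy poweRyr ?ltxx//.
have g2 : square_integrable q.
  split => //; apply/integrableP; split => //.
  under eq_integral do rewrite gee0_abs ?lee_fin ?sqr_ge0//.
  exact: Ioo.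
split => //; rewrite /L2norm IE.
rewrite -[X in (X `^ _)%E]fineK ?ge0_fin_numE//.
by rewrite poweR_EFin powR12_sqrt// fine_ge0.
Qed.

(** For rho = s + i b one has c = i rho = -b + i s and lambda = rho^2 = -c^2. Existence makes the
    set in [weyl_function] inhabited, so [xget] returns the derivative of some Weyl solution,
    possibly other than the given one. *)
Lemma weyl_function_spec q k (b s : R) :
  (forall j, cmeasurable_fun `[0, pi] (q j)) ->
  (exists y dy, star_solution (Complex (- b) s) 1 k (fun j x => q j x * y j x) y dy) ->
  exists y dy, star_solution (Complex (- b) s) 1 k (fun j x => q j x * y j x) y dy /\
    weyl_function q k (Complex s b ^+ 2) = dy k 0.
Proof.
move=> mq [y [dy ss]]; set c := Complex (- b) s.
have lamE : Complex s b ^+ 2 = - c ^+ 2.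
  by rewrite !expr2; apply: complex_ext; rewrite ?cReN ?cImN ?cReM ?cImM /=; ring.
have : exists m, [set m | exists y dy, weyl_solution q k (Complex s b ^+ 2) y dy /\ m = dy k 0] m.
  exists (dy k 0), y, dy; split => //; have [es mt h1 h2] := ss; split => //.
  - split => // j; have [acy acd] := es j; apply: AC_SL_solution => //.
    by apply: AC_eq acd _ _ => // x _; rewrite lamE /c; ring.
  - by move=> j jn; rewrite h2// mul1r.
move=> /(xgetPex 0) [y' [dy' [[[es mt] h1 h2] Wm]]].
exists y', dy'; split; last exact: Wm.
split => //.
- move=> j; have [acy acd] := SL_solutionP (mq j) (es j); split => //.
  by apply: AC_eq acd _ _ => // x _; rewrite lamE /c; ring.
- by move=> j jn; rewrite h2// mul1r.
Qed.

(** As e^(2 c x) = e^(-2 b x) e^(2 i s x), moving the real factor into p leaves a Fourier integral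
    at the real frequency s; the reversed version serves e^(2 c (pi - x)). *)
Definition damped (p : R -> R[i]) (b x : R) : R[i] := p x * Complex (expR (- 2 * b * x)) 0.
Definition damped_rev (p : R -> R[i]) (b x : R) : R[i] :=
  p x * Complex (expR (- 2 * b * (pi - x))) 0.

Lemma cexp_damped (b s x : R) (c := Complex (- b) s : R[i]) :
  cexp (c + c) x = Complex (expR (- 2 * b * x)) 0 * osc s x.
Proof.
have -> : c + c = Complex (- 2 * b) 0 + Complex 0 (2 * s).
  by apply: complex_ext; rewrite !(cReD, cImD) /c /=; ring.
rewrite cexpDl; congr (_ * _).
by rewrite /cexp /= mul0r cos0 sin0 mulr0 mulr1.
Qed.

Lemma oscB (s x y : R) : osc s x * osc (- s) y = osc s (x - y).
Proof.
rewrite /osc cexpD; congr (_ * _).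
by rewrite -cexpNl; congr (cexp _ y); apply: complex_ext; rewrite /= ?oppr0 ?mulrN.
Qed.

Lemma fourier_damped (p : R -> R[i]) (b s : R) (c := Complex (- b) s : R[i]) :
  cintegral `[0, pi] (fun x => p x * cexp (c + c) x) = fourier (damped p b) s.
Proof. by apply: eq_cintegral => x _; rewrite /damped -mulrA cexp_damped. Qed.

(** The phase e^(2 i s pi) does not depend on x and has modulus 1, so it disappears; the frequency
    changes sign. *)
Lemma fourier_damped_rev (p : R -> R[i]) (b s : R) (c := Complex (- b) s : R[i]) :
  cintegrable `[0, pi] (damped_rev p b) ->
  normc (cintegral `[0, pi] (fun x => p x * cexp (c + c) (pi - x))) =
  normc (fourier (damped_rev p b) (- s)).
Proof.
move=> di; rewrite -[RHS]mul1r -(normc_osc s pi) -Normc.normcM /fourier -cintegralZ//; last first.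
  exact: cintegrable_osc.
congr normc; apply: eq_cintegral => x _; rewrite /damped_rev cexp_damped -oscB.
by ring.
Qed.

Lemma square_integrable_damped (p : R -> R[i]) (b : R) : 0 <= b -> square_integrable p ->
  [/\ square_integrable (damped p b), square_integrable (damped_rev p b),
      Rintegral mu `[0, pi] (fun x => normc (damped p b x) ^+ 2) <=
        Rintegral mu `[0, pi] (fun x => normc (p x) ^+ 2) &
      Rintegral mu `[0, pi] (fun x => normc (damped_rev p b x) ^+ 2) <=
        Rintegral mu `[0, pi] (fun x => normc (p x) ^+ 2)].
Proof.
move=> b0 p2.
have cE (a : R -> R) : continuous a ->
    cmeasurable_fun `[0, pi] (fun x => p x * Complex (expR (a x)) 0).
  move=> ca; apply: cmeasurableM; first exact: p2.1.
  split => /=; last exact: measurable_cst.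
  apply: measurable_funS (continuous_measurable_fun _) => //.
  by move=> x; apply: continuous_comp; [exact: ca|exact: continuous_expR].
have m1 : cmeasurable_fun `[0, pi] (damped p b).
  by apply: cE => x; apply: cvgM; [exact: cvg_cst|exact: cvg_id].
have m2 : cmeasurable_fun `[0, pi] (damped_rev p b).
  apply: cE => x; apply: cvgM; first exact: cvg_cst.
  by apply: cvgB; [exact: cvg_cst|exact: cvg_id].
have n1 x : 0 <= x <= pi -> normc (damped p b x) <= normc (p x).
  move=> xpi; rewrite Normc.normcM normc_real ger0_norm ?expR_ge0//.
  rewrite ler_piMr ?normc_ge0// -[leRHS]expR0 ler_expR; nra.
have n2 x : 0 <= x <= pi -> normc (damped_rev p b x) <= normc (p x).
  move=> xpi; rewrite Normc.normcM normc_real ger0_norm ?expR_ge0//.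
  rewrite ler_piMr ?normc_ge0// -[leRHS]expR0 ler_expR; nra.
have s1 : square_integrable (damped p b).
  by apply: (square_integrable_le (C := 1) m1 _ p2) => x /n1; rewrite mul1r.
have s2 : square_integrable (damped_rev p b).
  by apply: (square_integrable_le (C := 1) m2 _ p2) => x /n2; rewrite mul1r.
split => //; apply: le_Rintegral => //; try exact: s1.2; try exact: s2.2; try exact: p2.2.
- move=> x /=; rewrite in_itv/= => /n1 h.
  by rewrite ler_pXn2r ?nnegrE ?normc_ge0.
- move=> x /=; rewrite in_itv/= => /n2 h.
  by rewrite ler_pXn2r ?nnegrE ?normc_ge0.
Qed.

Variables (b Q : R).
Hypotheses (N0 : (0 < N)%N) (b0 : 0 < b) (Eb : expR (- b * pi) <= 1 / 2)
  (Qb : 17 * Q <= b).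

Lemma weyl_difference_le q qt k (s : R) : val k != 0%N ->
  (forall j, square_integrable (q j)) -> (forall j, square_integrable (qt j)) ->
  (forall j, Rintegral mu `[0, pi] (fun x => normc (q j x)) <= Q) ->
  (forall j, Rintegral mu `[0, pi] (fun x => normc (qt j x)) <= Q) ->
  (forall j, cintegral `[0, pi] (fun x => qt j x - q j x) = 0) ->
  normc (weyl_function q k (Complex s b ^+ 2) - weyl_function qt k (Complex s b ^+ 2)) <=
  \sum_j (25 / 4 * (normc (fourier (damped (fun x => qt j x - q j x) b) s) +
                    normc (fourier (damped_rev (fun x => qt j x - q j x) b) (- s))) +
          15 * (85 * Q) * Rintegral mu `[0, pi] (fun x => normc (qt j x - q j x))
            / normc (Complex s b)).
Proof.
move=> k0 q2 qt2 qQ qtQ pm0.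
set c : R[i] := Complex (- b) s.
have nc : normc (Complex s b) = normc c by rewrite /= sqrrN addrC.
have bc : b <= normc c.
  by have := ler_Re_normc c; rewrite /c/= normrN gtr0_norm.
have cgt : 0 < normc c by exact: lt_le_trans bc.
have c0 : c != 0 by apply: contraTneq cgt => ->; rewrite Normc.normc0 ltxx.
have Rec : Re c <= 0 by rewrite /= oppr_le0 ltW.
have E2 : normc (cexp c pi) <= 1 / 2 by rewrite normc_cexp.
have Qc : 17 / 2 * Q / normc c <= 1 / 2.
  rewrite ler_pdivrMr// (_ : 17 / 2 * Q = 1 / 2 * (17 * Q)); last by field.
  by rewrite ler_wpM2l ?divr_ge0//; exact: le_trans bc.
have qi j := square_integrable_integrable (q2 j).
have qti j := square_integrable_integrable (qt2 j).
have [y [dy [ss ->]]] := @weyl_function_spec q k b s (fun j => (q2 j).1)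
  (star_potential_exists N0 k0 c0 Rec E2 qi qQ Qc 1).
have [z [dz [st ->]]] := @weyl_function_spec qt k b s (fun j => (qt2 j).1)
  (star_potential_exists N0 k0 c0 Rec E2 qti qtQ Qc 1).
have [y0 [dy0 s0]] : exists y0 dy0, star_solution c 1 k (fun _ _ => 0) y0 dy0.
  by apply: star_solution_exists => // j; have [] := AC_cst (0 : R[i]).
have yb := star_potential_le N0 k0 c0 Rec E2 qi qQ Qc ss.
have zb := star_potential_le N0 k0 c0 Rec E2 qti qtQ Qc st.
rewrite Normc.normc1 mulr1 in yb zb.
(* The difference w - y0 has zero end values and forcing p w, of L1 norm at most 10 Q;
   [star_solution_le] gives 17/2 times 10 Q / |c|, that is 85 Q / |c|. *)
have close (p w dw : 'I_N -> R -> R[i]) : (forall j, cintegrable `[0, pi] (p j)) ->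
    (forall j, Rintegral mu `[0, pi] (fun x => normc (p j x)) <= Q) ->
    star_solution c 1 k (fun j x => p j x * w j x) w dw ->
    (forall j x, 0 <= x <= pi -> normc (w j x) <= 10) ->
    forall j x, 0 <= x <= pi -> normc (w j x - y0 j x) <= 85 * Q / normc c.
  move=> pint pQ sw wb j x xpi.
  have sd := star_solutionB sw s0; rewrite subrr in sd.
  have fK i : Rintegral mu `[0, pi] (fun t => normc (p i t * w i t - 0)) <= Q * 10.
    have [es _ _ _] := sw.
    have := Rintegral_normcM_le (pint i) (AC_measurable (es i).1) (pQ i) (wb i).
    by under eq_Rintegral do rewrite -[_ * w i _]subr0.
  have n0 : normc (0 : R[i]) <= 0 by rewrite Normc.normc0.
  have h := star_solution_le N0 k0 c0 Rec E2 sd n0 fK j xpi.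
  apply: (le_trans h); rewrite mulr0 add0r.
  by rewrite le_eqVlt; apply/orP; left; apply/eqP; field; rewrite gt_eqF.
rewrite (star_wronskian N0 k0 ss st).
apply: (le_trans (ler_normc_sum _ _ _)); apply: ler_sum => j _.
have p2 : square_integrable (fun x => qt j x - q j x).
  apply: square_integrableD => //.
  apply: (square_integrable_le (C := 1) _ _ (q2 j)); first exact: cmeasurableN (q2 j).1.
  by move=> x _; rewrite normcN mul1r.
have pint := square_integrable_integrable p2.
have [al [be [hal hbe y0E]]] := star_free_expansion j N0 k0 c0 Rec E2 s0.
have [ey _ _ _] := ss; have [ez _ _ _] := st.
have := edge_integral_le Rec pint (pm0 j) (AC_measurable (ey j).1) (AC_measurable (ez j).1)
  hal hbe y0E (close q y dy qi qQ ss yb j) (close qt z dz qti qtQ st zb j) (zb j).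
have [d1 d2 _ _] := square_integrable_damped (ltW b0) p2.
have e1 : normc (cintegral `[0, pi] (fun x => (qt j x - q j x) * cexp (c + c) x)) =
    normc (fourier (damped (fun x => qt j x - q j x) b) s).
  by congr normc; exact: fourier_damped.
have e2 := fourier_damped_rev s (square_integrable_integrable d2).
rewrite -/c in e2; rewrite e1 e2.
move=> /le_trans; apply; rewrite lerD2l nc le_eqVlt; apply/orP; left; apply/eqP.
by move: (Rintegral _ _ _) (normc c)^-1 => I n; ring.
Qed.

End WeylFunction.

(** * Integration over the line and the final estimate *)

Section WeylDistance.
Context {R : realType} {N : nat}.
Notation mu := (@lebesgue_measure R).
Implicit Types (q qt : 'I_N -> R -> R[i]) (j k : 'I_N).

Lemma integral_le_fourier (g : R -> R[i]) (P : R) : square_integrable g ->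
  Rintegral mu `[0, pi] (fun x => normc (g x) ^+ 2) <= P ->
  integral_le (fun s => normc (fourier g s) ^+ 2) (pi * P) /\
  integral_le (fun s => normc (fourier g (- s)) ^+ 2) (pi * P).
Proof.
move=> g2 gP; have gi := square_integrable_integrable g2.
have cf := continuous_sqr_fourier gi.
have le : ((pi * Rintegral mu `[0, pi] (fun x => normc (g x) ^+ 2))%:E <= (pi * P)%:E)%E.
  by rewrite lee_fin ler_wpM2l ?pi_ge0.
split; split; try by move=> x; exact: sqr_ge0.
- exact: continuous_measurable_fun.
- exact: le_trans (fourier_le g2) le.
- apply: (continuous_measurable_fun (f := (fun s => normc (fourier g s) ^+ 2) \o -%R)).
  by move=> x; apply: continuous_comp; [exact: opp_continuous|exact: cf].
- exact: le_trans (fourier_opp_le g2) le.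
Qed.

(** The bound per edge and unit of squared norm. The factors 3 come from squaring three terms, 2 pi
    from the two Fourier integrals, the first pi of the remainder from the Cauchy-Schwarz inequality
    on an edge, and (1 + b^-2) pi bounds the integral of 1 / |rho|^2. *)
Definition distance_const (b Q : R) : R :=
  3 * (25 / 4) ^+ 2 * (2 * pi) + 3 * (15 * (85 * Q)) ^+ 2 * pi * (1 + (b ^+ 2)^-1) * pi.

Lemma remainder_const_ge0 (b Q : R) :
  0 <= 3 * (15 * (85 * Q)) ^+ 2 * pi * (1 + (b ^+ 2)^-1).
Proof.
apply: mulr_ge0; last by rewrite addr_ge0// invr_ge0 sqr_ge0.
by apply: mulr_ge0; [apply: mulr_ge0 => //; exact: sqr_ge0|exact: pi_ge0].
Qed.

Lemma distance_const_ge0 (b Q : R) : 0 <= distance_const b Q.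
Proof.
apply: addr_ge0; apply: mulr_ge0; try exact: pi_ge0.
- by apply: mulr_ge0 => //; exact: sqr_ge0.
- by apply: mulr_ge0 => //; exact: pi_ge0.
- exact: remainder_const_ge0.
Qed.

Lemma weyl_difference_integral_le (b Q P : R) q qt k : (0 < N)%N -> 0 < b ->
  expR (- b * pi) <= 1 / 2 -> 17 * Q <= b -> val k != 0%N ->
  (forall j, square_integrable (q j)) -> (forall j, square_integrable (qt j)) ->
  (forall j, Rintegral mu `[0, pi] (fun x => normc (q j x)) <= Q) ->
  (forall j, Rintegral mu `[0, pi] (fun x => normc (qt j x)) <= Q) ->
  (forall j, cintegral `[0, pi] (fun x => qt j x - q j x) = 0) ->
  (forall j, Rintegral mu `[0, pi] (fun x => normc (qt j x - q j x) ^+ 2) <= P) ->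
  (\int[mu]_s (normc (weyl_function q k (Complex s b ^+ 2) -
                      weyl_function qt k (Complex s b ^+ 2)) ^+ 2)%:E <=
   (2 ^+ N * (N%:R * (distance_const b Q * P)))%:E)%E.
Proof.
move=> N0 b0 Eb Qb k0 q2 qt2 qQ qtQ pm0 pP.
pose p j x := qt j x - q j x.
have p2 j : square_integrable (p j).
  apply: square_integrableD => //.
  apply: (square_integrable_le (C := 1) _ _ (q2 j)); first exact: cmeasurableN (q2 j).1.
  by move=> x _; rewrite normcN mul1r.
have P0 : 0 <= P.
  apply: le_trans (pP k); apply: Rintegral_ge0 => x _; exact: sqr_ge0.
pose K1 : R := 3 * (25 / 4) ^+ 2.
pose K2 : R := 3 * (15 * (85 * Q)) ^+ 2 * pi * (1 + (b ^+ 2)^-1) * P.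
have K20 : 0 <= K2 by apply: mulr_ge0 => //; exact: remainder_const_ge0.
pose A j s := normc (fourier (damped (p j) b) s).
pose B j s := normc (fourier (damped_rev (p j) b) (- s)).
pose G j s := K1 * (A j s ^+ 2 + B j s ^+ 2) + K2 * (oneDsqr s)^-1.
have GC j : integral_le (G j) (K1 * (pi * P + pi * P) + K2 * pi).
  have [d1 d2 l1 l2] := square_integrable_damped (ltW b0) (p2 j).
  have [h1 _] := integral_le_fourier d1 (le_trans l1 (pP j)).
  have [_ h2] := integral_le_fourier d2 (le_trans l2 (pP j)).
  apply: integral_leD; apply: integral_leZ => //.
  - by rewrite /K1 mulr_ge0// sqr_ge0.
  - exact: (integral_leD h1 h2).
  - exact: integral_le_oneDsqrV.
have [_ _] := integral_leZ (exprn_ge0 N (ler0n R 2)) (integral_le_sum (index_enum _) GC).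
rewrite sumr_const card_ord -[_ *+ N]mulr_natl.
have -> : K1 * (pi * P + pi * P) + K2 * pi = distance_const b Q * P.
  by rewrite /K1 /K2 /distance_const; move: (@pi R) (b ^+ 2)^-1 => w v; ring.
(* From here the task is pointwise in s: the squared difference is compared with the measurable
   majorant built from [G]. *)
apply: le_trans; apply: ge0_le_integralT => [s|s]; first by rewrite lee_fin sqr_ge0.
rewrite lee_fin.
have wd := @weyl_difference_le R N b Q N0 b0 Eb Qb q qt k s k0 q2 qt2 qQ qtQ pm0.
apply: (le_trans (ler_pM (normc_ge0 _) (normc_ge0 _) wd wd)).
apply: (le_trans (sqr_sum_le _ _)); rewrite -[index_enum _]enumT size_enum_ord enumT.
rewrite ler_wpM2l ?exprn_ge0//; apply: ler_sum => j _.
rewrite -/(p j) -/(A j s) -/(B j s).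
set I := Rintegral _ _ _; set n := normc _.
have n2 : n ^+ 2 = s ^+ 2 + b ^+ 2 by rewrite /n sqr_normc.
have b2 : 0 < b ^+ 2 by rewrite exprn_gt0.
have n20 : 0 < n ^+ 2 by rewrite n2 ltr_wpDl// sqr_ge0.
have I2 : I ^+ 2 <= pi * P.
  apply: (le_trans (sqr_Rintegral_normc_le (p2 j))).
  by apply: ler_wpM2l; [exact: pi_ge0|exact: pP].
(* Replaces 1 / (s^2 + b^2) by a multiple of 1 / (1 + s^2), whose integral is pi. *)
have nV : (n ^+ 2)^-1 <= (1 + (b ^+ 2)^-1) * (oneDsqr s)^-1.
  have o0 : 0 < oneDsqr s by rewrite (lt_le_trans ltr01)// oneDsqr_ge1.
  rewrite ler_pdivlMr// ler_pdivrMl// n2 /oneDsqr mulrDr mulr1.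
  have -> : (s ^+ 2 + b ^+ 2) / b ^+ 2 = s ^+ 2 / b ^+ 2 + 1 by field; rewrite gt_eqF.
  have : 0 <= s ^+ 2 / b ^+ 2 by rewrite divr_ge0 ?sqr_ge0.
  lra.
set C := 15 * (85 * Q) * I / n.
have C2 : C ^+ 2 <= (15 * (85 * Q)) ^+ 2 * (pi * P) * ((1 + (b ^+ 2)^-1) * (oneDsqr s)^-1).
  rewrite /C expr_div_n exprMn; apply: ler_pM => //.
  - by rewrite mulr_ge0 ?sqr_ge0.
  - by rewrite invr_ge0 ltW.
  - by rewrite ler_wpM2l// sqr_ge0.
have -> : G j s = K1 * (A j s ^+ 2 + B j s ^+ 2) +
    3 * ((15 * (85 * Q)) ^+ 2 * (pi * P) * ((1 + (b ^+ 2)^-1) * (oneDsqr s)^-1)).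
  rewrite /G /K2; congr (_ + _).
  by move: (@pi R) (b ^+ 2)^-1 (oneDsqr s)^-1 => w v u; ring.
apply: (@le_trans _ _ (K1 * (A j s ^+ 2 + B j s ^+ 2) + 3 * C ^+ 2)); last first.
  by rewrite lerD2l ler_wpM2l.
rewrite /K1; move: (A j s) (B j s) C {C2} => x y z.
(* The identity 3 (x^2 + y^2 + z^2) - (x + y + z)^2 = (x - y)^2 + (x - z)^2 + (y - z)^2. *)
rewrite -subr_ge0 (_ : _ - _ = (25 / 4 * x - 25 / 4 * y) ^+ 2 + (25 / 4 * x - z) ^+ 2 +
  (25 / 4 * y - z) ^+ 2); first by rewrite !addr_ge0 ?sqr_ge0.
by field.
Qed.

Lemma cintegral_oo_cc (f : R -> R[i]) : cintegrable `[0, pi] f ->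
  cintegral `]0, pi[ f = cintegral `[0, pi] f.
Proof.
move=> [f1 f2]; have s1 : `]0, pi[ `<=` `[(0 : R), pi].
  by move=> x /=; rewrite !in_itv/= => /andP[/ltW -> /ltW ->].
have s2 : `]0, pi] `<=` `[(0 : R), pi].
  by move=> x /=; rewrite !in_itv/= => /andP[/ltW -> ->].
apply: complex_ext => /=.
- rewrite Rintegral_itv_bndo_bndc; last exact: integrableS f1.
  by rewrite Rintegral_itv_obnd_cbnd//; exact: integrableS f1.
- rewrite Rintegral_itv_bndo_bndc; last exact: integrableS f2.
  by rewrite Rintegral_itv_obnd_cbnd//; exact: integrableS f2.
Qed.

Lemma L2norm_potential_le q j (D : R) : potential q ->
  (L2norm `]0%R, pi[ (q j) <= D%:E)%E ->
  0 <= D /\ Rintegral mu `[0, pi] (fun x => normc (q j x) ^+ 2) <= D ^+ 2.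
Proof.
move=> /(_ j) /inL2_spec [_ ->]; rewrite lee_fin => h.
have D0 : 0 <= D by apply: le_trans h; exact: sqrtr_ge0.
have I0 : 0 <= Rintegral mu `[0, pi] (fun x => normc (q j x) ^+ 2).
  by apply: Rintegral_ge0 => x _; exact: sqr_ge0.
by split => //; rewrite -(sqr_sqrtr I0) ler_pXn2r ?nnegrE ?sqrtr_ge0.
Qed.

(** The Cauchy-Schwarz inequality on an interval of length pi; it is the origin of Q = sqrt(pi)
    r. *)
Lemma potential_norm_L1_le q (r : R) j : 0 < r -> potential q ->
  (potential_norm q < r%:E)%E ->
  Rintegral mu `[0, pi] (fun x => normc (q j x)) <= Num.sqrt pi * r.
Proof.
move=> r0 pq nq; have [q2 _] := inL2_spec (pq j).
have [_ h] : 0 <= r /\ Rintegral mu `[0, pi] (fun x => normc (q j x) ^+ 2) <= r ^+ 2.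
  apply: L2norm_potential_le => //; apply: le_trans (ltW nq).
  exact: (le_bigmax _ (fun j => L2norm `]0, pi[ (q j))).
rewrite -(ler_pXn2r (n := 2)) ?nnegrE//; last 2 first.
- by apply: Rintegral_ge0 => x _; exact: normc_ge0.
- by rewrite mulr_ge0 ?sqrtr_ge0// ltW.
apply: (le_trans (sqr_Rintegral_normc_le q2)).
by rewrite exprMn sqr_sqrtr ?pi_ge0// ler_wpM2l ?pi_ge0.
Qed.

End WeylDistance.

Theorem theorem2 (R : realType) (N : nat) (hN : (2 <= N)%N) (r : R)
    (hr : 0 < r) :
  exists A : R, 0 < A /\
    forall q qt : 'I_N -> R -> R[i],
      potential q -> potential qt ->
      (forall j : 'I_N, omega q j = omega qt j) ->
      (potential_norm q < r%:E)%E ->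
      (potential_norm qt < r%:E)%E ->
      (weyl_dist (line_height N r) q qt <=
         A%:E * potential_norm (fun j x => q j x - qt j x)%R)%E.
Proof.
have N0 : (0 < N)%N by exact: ltnW.
have [b0 Eb Qb] := line_height_spec hN hr.
set b := line_height N r in b0 Eb Qb *; set Q := Num.sqrt pi * r in Qb.
set K := 2 ^+ N * (N%:R * distance_const b Q).
have K0 : 0 <= K.
  apply: mulr_ge0; first exact: exprn_ge0.
  by apply: mulr_ge0 => //; exact: distance_const_ge0.
(* Adding 1 secures strict positivity. *)
exists (Num.sqrt K + 1); split; first by rewrite ltr_wpDl// sqrtr_ge0.
move=> q qt pq pqt om nq nqt.
have q2 j := (inL2_spec (pq j)).1; have qt2 j := (inL2_spec (pqt j)).1.
have pd : potential (fun j x => q j x - qt j x).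
  move=> j; have [mq _] := pq j; have [mqt _] := pqt j.
  have d2 : square_integrable (fun x => q j x - qt j x).
    apply: square_integrableD => //.
    apply: (square_integrable_le (C := 1) _ _ (qt2 j)); first exact: cmeasurableN (qt2 j).1.
    by move=> x _; rewrite normcN mul1r.
  split; first by apply: cmeasurableD => //; exact: cmeasurableN.
  apply: poweR_lty; apply: integrable_lty => //.
  apply: integrableS d2.2 => // x /=.
  by rewrite !in_itv/= => /andP[/ltW -> /ltW ->].
set nd := potential_norm _.
have nd0 : (0 <= nd)%E by rewrite /nd /potential_norm; exact: bigmax_ge_id.
have ndoo : (nd < +oo)%E.
  by apply: bigmax_lt => // j _; have [] := pd j.
have [D ndE] : exists D : R, nd = D%:E.
  by exists (fine nd); rewrite fineK// ge0_fin_numE.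
have pP j : Rintegral lebesgue_measure `[0, pi] (fun x => normc (qt j x - q j x) ^+ 2) <= D ^+ 2.
  have h : (L2norm `]0%R, pi[ (fun x => (q j x - qt j x)%R) <= D%:E)%E.
    by rewrite -ndE; exact: (le_bigmax _ (fun j => L2norm `]0, pi[ (fun x => q j x - qt j x))).
  have [_] := L2norm_potential_le pd h.
  by under eq_Rintegral do rewrite normc_distC.
have D0 : 0 <= D by rewrite -lee_fin -ndE.
(* The equality of the numbers omega enters here, as the mean-zero condition on each edge. *)
have pm0 j : cintegral `[0, pi] (fun x => qt j x - q j x) = 0.
  have qi := square_integrable_integrable (q2 j).
  have qti := square_integrable_integrable (qt2 j).
  rewrite cintegralB// -!cintegral_oo_cc//; apply/eqP; rewrite subr_eq0; apply/eqP.
  have h2 : (2^-1 : R[i]) != 0 by rewrite invr_eq0 pnatr_eq0.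
  by have := om j; rewrite /omega => /(mulfI h2) ->.
rewrite ndE -EFinM; apply: bigmax_le.
  by rewrite lee_fin mulr_ge0// addr_ge0// sqrtr_ge0.
move=> k k0.
have := weyl_difference_integral_le N0 b0 Eb Qb k0 q2 qt2
  (fun j => potential_norm_L1_le j hr pq nq) (fun j => potential_norm_L1_le j hr pqt nqt) pm0 pP.
rewrite mulrA mulrA -[2 ^+ N * _ * _]mulrA -/K /L2norm.
have : (0 <= \int[lebesgue_measure]_s (normc (weyl_function q k (Complex s b ^+ 2) -
                      weyl_function qt k (Complex s b ^+ 2)) ^+ 2)%:E)%E.
  by apply: integral_ge0 => s _; rewrite lee_fin sqr_ge0.
(* The finite upper bound excludes +oo and nonnegativity excludes -oo. *)
case: (integral _ _ _) => [t| |]//; rewrite !lee_fin => t0 tK.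
rewrite powR12_sqrt// mulrDl mul1r.
apply: (@le_trans _ _ (Num.sqrt (K * D ^+ 2))); first exact: ler_wsqrtr.
by rewrite sqrtrM// sqrtr_sqr ger0_norm// lerDl.
Qed.
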